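(* Let $\mu$ be as in the context and suppose that for some $r_0\in[0,\infty)$ the partial super Poincaré inequality holds for $r>r_0$ with some function $\beta$. Then for every $\kappa\in(0,1/2]$ there is a constant $C_\kappa>0$ such that \[\forall A\text{ measurable},\quad \mu(A)\le\kappa\ \Longrightarrow\ \operatorname{cap}_\mu(A)\ge C_\kappa\,\mu(A),\] and the constants can be chosen so that $\liminf_{\kappa\to0}C_\kappa\ge 1/r_0$ (with $1/0=+\infty$; in particular $C_\kappa\to\infty$ as $\kappa\to0$ if the full super Poincaré inequality holds).
   Context: Setting: $V:\mathbb R^n\to\mathbb R$ smooth with $\int e^{-V}dx<\infty$, $\mu(dx)=Z^{-1}e^{-V(x)}dx$ a probability measure on $\mathbb R^n$; ''admissible $f$'' means $f\in L^2(\mu)$ locally Lipschitz with $\int|\nabla f|^2d\mu<\infty$. Partial super Poincaré inequality for $r>r_0$: for every $r>r_0$ there is $\beta(r)<\infty$ with $\int f^2d\mu\le r\int|\nabla f|^2d\mu+\beta(r)(\int|f|d\mu)^2$ for all admissible $f$ (full SPI: $r_0=0$). Capacity: for measurable $A$ with $\mu(A)\le1/2$, $\operatorname{cap}_\mu(A)=\inf\{\int|\nabla f|^2d\mu : f\text{ admissible},\ \mathbf 1_A\le f\le1,\ \mu(\{f\neq0\})\le1/2\}$. *)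

(* Defs.v *)
From HB Require Import structures.
From mathcomp Require Import all_boot all_order all_algebra.
From mathcomp Require Import all_classical all_reals all_analysis.
Set Implicit Arguments. Unset Strict Implicit. Unset Printing Implicit Defensive.
Import Order.TTheory GRing.Theory Num.Theory.
Import numFieldNormedType.Exports.
Local Open Scope classical_set_scope.
Local Open Scope ring_scope.

Definition Rn (R : realType) (n : nat) : Type := 'rV[R]_n.

Section Rn_instances.
Variables (R : realType) (n : nat).
HB.instance Definition _ := NormedModule.on (Rn R n).

Definition borel_Rn : set (set (Rn R n)) := <<s [set U : set (Rn R n) | open U] >>.

Let borel0 : borel_Rn set0.
Proof. exact: sigma_algebra0. Qed.
Let borelC (A : set (Rn R n)) : borel_Rn A -> borel_Rn (~` A).
Proof. by move=> h; rewrite -setTD; exact: sigma_algebraCD. Qed.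
Let borelU (F : (set (Rn R n))^nat) : (forall i, borel_Rn (F i)) ->
  borel_Rn (\bigcup_i F i).
Proof. exact: sigma_algebra_bigcup. Qed.

HB.instance Definition _ := @isMeasurable.Build default_measure_display
  (Rn R n) borel_Rn borel0 borelC borelU.
End Rn_instances.

(* Lebesgue measure on the Borel sets of R^n, characterised (uniquely) as the
   Borel measure giving every closed box its volume. *)
Definition is_lebesgue_Rn (R : realType) (n : nat)
    (lam : {measure set (Rn R n) -> \bar R}) : Prop :=
  forall a b : Rn R n, (forall i, a ord0 i <= b ord0 i) ->
    lam [set x : Rn R n | forall i, a ord0 i <= x ord0 i <= b ord0 i]
    = (\prod_(i < n) (b ord0 i - a ord0 i))%:E.

Definition evec (R : realType) (n : nat) (i : 'I_n) : Rn R n := delta_mx ord0 i.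
Definition partial (R : realType) (n : nat) (i : 'I_n) (f : Rn R n -> R) :
  Rn R n -> R := fun x => 'D_(evec R i) f x.

Fixpoint Ck (R : realType) (n : nat) (k : nat) (f : Rn R n -> R) : Prop :=
  match k with
  | 0%N => continuous f
  | k'.+1 => (forall x, differentiable f x) /\ forall i, Ck k' (partial i f)
  end.
Definition smooth (R : realType) (n : nat) (f : Rn R n -> R) : Prop :=
  forall k, Ck k f.

(* Euclidean norm of the gradient (defined wherever f is differentiable,
   i.e. almost everywhere for locally Lipschitz f by Rademacher; 0 elsewhere) *)
Definition gradnorm (R : realType) (n : nat) (f : Rn R n -> R) (x : Rn R n) : R :=
  if `[< differentiable f x >] then Num.sqrt (\sum_(i < n) (partial i f x) ^+ 2)
  else 0.

Definition locally_lipschitz (R : realType) (n : nat) (f : Rn R n -> R) : Prop :=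
  forall x : Rn R n, exists2 r : R, 0 < r & [lipschitz f y | y in ball x r].

Definition admissible (R : realType) (n : nat)
    (mu : {measure set (Rn R n) -> \bar R}) (f : Rn R n -> R) : Prop :=
  locally_lipschitz f /\
  (\int[mu]_x ((f x) ^+ 2)%:E < +oo)%E /\
  (\int[mu]_x ((gradnorm f x) ^+ 2)%:E < +oo)%E.

Definition partial_SPI (R : realType) (n : nat)
    (mu : {measure set (Rn R n) -> \bar R}) (r0 : R) (beta : R -> R) : Prop :=
  forall r : R, r0 < r -> forall f : Rn R n -> R, admissible mu f ->
    (\int[mu]_x ((f x) ^+ 2)%:E <=
       r%:E * \int[mu]_x ((gradnorm f x) ^+ 2)%:E
       + (beta r)%:E * ((\int[mu]_x `|f x|%:E) * (\int[mu]_x `|f x|%:E)))%E.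

(* capacity of A (meaningful for mu A <= 1/2); inf of the empty set is +oo *)
Definition capacity (R : realType) (n : nat)
    (mu : {measure set (Rn R n) -> \bar R}) (A : set (Rn R n)) : \bar R :=
  ereal_inf [set (\int[mu]_x ((gradnorm f x) ^+ 2)%:E)%E | f in
    [set f : Rn R n -> R | admissible mu f /\
       (forall x, A x -> 1 <= f x) /\ (forall x, f x <= 1) /\
       (mu [set x | f x != 0%R] <= (2^-1)%:E)%E]].

(* Main.v *)
Require Import Defs.
From HB Require Import structures.
From mathcomp Require Import all_boot all_order all_algebra.
From mathcomp Require Import ring lra.
From mathcomp Require Import all_classical all_reals all_analysis.
From mathcomp Require Import measurable_realfun.
Import Order.TTheory GRing.Theory Num.Theory.
Import numFieldNormedType.Exports.
Local Open Scope classical_set_scope.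
Local Open Scope ring_scope.

(** Let [f] be a test function for the capacity of [A] and fix [eps > 0]. If
[mu (f > eps)] is small compared with [1 / beta r], the inequality applied to the
truncation [(f - eps)^+], whose gradient is dominated by that of [f] everywhere, absorbs
the [L^1] term by Cauchy-Schwarz and gives
[(1 - eta) (1 - eps)^2 mu A <= r * energy f]. Otherwise [f] vanishes on a set of measure
at least [1/2] and exceeds [eps] on a set of measure bounded below; since [mu] is
comparable to Lebesgue measure on cubes, a local Poincare inequality on a large cube
bounds the energy of [f] from below by a constant independent of [A], which beats
[c * mu A] once [mu A] is small. The local Poincare inequality integrates
[|F (x + v) - F x| <= |v| \int_0^1 lip F (x + s v) ds] over [x] and [v]; comparing the
pointwise Lipschitz constant [lip F] with the norm of the gradient requires Rademacher's
theorem. *)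

(** * Lipschitz functions on the line *)

(** The support condition forces the dichotomy: with [mu (f != 0) <= 1/2] alone, Cauchy-Schwarz
    bounds the [L^1] term by [beta r / 2] times the integral of [f^2], which cannot be absorbed once
    [beta r >= 2]. Letting [r] tend to [r0] and [eps], [eta] to 0 gives the sharp constant [1/r0].

    The second obstacle is [gradnorm]: it is 0 wherever [f] is not differentiable, and the proof
    treats it as a function without known measurability. Energies are therefore handled as lower
    integrals, which are monotone but not additive, so every comparison with [gradnorm] has to hold
    at all points. Moreover a single line may lie inside the null set of non-differentiability,
    where [gradnorm] is 0 although [f] varies along the line. The Borel function [lipnum] bounds the
    derivative along every line, so integration along segments and Tonelli are carried out with it,
    and [gradnorm] enters only at the end, off a null set of the cube. *)

Section LipschitzLine.
Variable R : realType.
Implicit Types (G g : R -> R).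

(** The function [x - G x] is again nondecreasing and right continuous. Its Stieltjes measure added
    to that of [G] agrees with Lebesgue measure on half-open intervals, hence everywhere. *)
Lemma stieltjes_le_lebesgue (G : cumulative R R) (A : set R) :
  (forall x y, x <= y -> G y - G x <= y - x) -> measurable A ->
  (lebesgue_stieltjes_measure G A <= lebesgue_measure A)%E.
Proof.
move=> G1 mA.
pose G' := fun x : R => x - G x.
have ndG' : {homo G' : x y / x <= y}.
  by move=> x y xy; rewrite /G'; have := G1 _ _ xy; lra.
have rcG' : right_continuous G'.
  move=> x; apply: cvgB; last exact: cumulative_is_right_continuous.
  exact: cvg_within.
pose H : cumulative R R := HB.pack G' (isCumulative.Build R _ R G' ndG' rcG').
pose nu : {measure set (measurableTypeR R) -> \bar R} :=
  measure_add (lebesgue_stieltjes_measure G) (lebesgue_stieltjes_measure H).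
have nuE X : nu X = (lebesgue_stieltjes_measure G X + lebesgue_stieltjes_measure H X)%E.
  exact: measure_addE.
rewrite (@lebesgue_measure_unique _ nu _ A mA); first by rewrite nuE leeDl.
move=> _ [[a b] _ <-]; rewrite nuE.
rewrite /lebesgue_measure /lebesgue_stieltjes_measure /measure_extension !measurable_mu_extE//=;
  try exact: is_ocitv.
have [ab|ba] := leP a b; first by rewrite !wlength_itv_bnd// -EFinD /H /= /G'; congr (_%:E); ring.
by rewrite set_itv_ge ?bnd_simp -?leNgt ?ltW// !wlength0 adde0.
Qed.

(** Domination by Lebesgue measure makes the Stieltjes measure of [G] absolutely continuous;
    restricted to []0, 1]] it is also finite, so Radon-Nikodym gives a density [phi]. The primitive
    of [phi] is [G - G 0] on [[0, 1]], and Lebesgue differentiation identifies the derivative in the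
    open interval. *)
Lemma lipschitz1_density (G : R -> R) :
  {homo G : x y / x <= y} -> (forall x y, x <= y -> G y - G x <= y - x) ->
  exists phi : R -> R,
    [/\ (@lebesgue_measure R).-integrable [set: R] (EFin \o phi),
      G 1 - G 0 = (\int[lebesgue_measure]_(t in `[0%R, 1%R]) phi t)%R &
      {ae (@lebesgue_measure R), forall x, 0 < x < 1 ->
        derivable G x 1 /\ 'D_1 G x = phi x}].
Proof.
move=> ndG G1.
have rcG : right_continuous G.
  move=> x; apply/cvgrPdist_le => e e0; near=> y.
  have xy : x <= y by near: y; exact: nbhs_right_ge.
  rewrite ler0_norm ?subr_le0 ?ndG// opprB (le_trans (G1 _ _ xy))// lerBlDl.
  by near: y; apply: nbhs_right_le; rewrite ltrDl.
pose F : cumulative R R := HB.pack G (isCumulative.Build R _ R G ndG rcG).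
have ls_itv (a b : R) : a <= b ->
    lebesgue_stieltjes_measure F `]a, b]%classic = (G b - G a)%:E.
  move=> ab; rewrite /lebesgue_stieltjes_measure /measure_extension measurable_mu_extE//=.
    by rewrite wlength_itv_bnd.
  exact: is_ocitv.
pose D : set (measurableTypeR R) := `]0%R, 1%R]%classic.
have mD : measurable D by exact: measurable_itv.
have Doo : (lebesgue_stieltjes_measure F D < +oo)%E by rewrite ls_itv// ltry.
pose nu : {finite_measure set (measurableTypeR R) -> \bar R} := mfrestr mD Doo.
have nuac : nu `<< @lebesgue_measure R.
  apply/null_content_dominatesP => A mA A0; apply/eqP; rewrite eq_le measure_ge0 andbT.
  rewrite /nu /= /mfrestr /mrestr -A0.
  apply: (@le_trans _ _ (lebesgue_measure (A `&` D))).
    by apply: stieltjes_le_lebesgue => //; exact: measurableI.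
  by apply: le_measure; rewrite ?inE//; exact: measurableI.
have [f [f0 ffin intf fE]] := radon_nikodym_sigma_finite nuac.
pose phi := fine \o f.
have fphi : f = EFin \o phi by apply/funext => x /=; rewrite /phi /= fineK.
rewrite fphi in intf fE.
have FE (x : R) : 0 <= x <= 1 ->
    (\int[lebesgue_measure]_(t in `]-oo, x]) phi t)%R = G x - G 0.
  move=> /andP[x0 x1]; rewrite /Rintegral -fE//.
  rewrite /nu /= /mfrestr /mrestr (_ : _ `&` _ = `]0%R, x]%classic) ?ls_itv//.
  apply/seteqP; split => t; rewrite /D /= !in_itv /=; first by case=> -> /andP[->].
  by move=> /andP[-> tx]; split => //=; exact: le_trans tx x1.
exists phi; split => //.
  rewrite -FE ?ler01 ?lexx//.
  rewrite -(Rintegral_itv_obnd_cbnd (b := BRight 1)); last exact: integrableS intf.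
  rewrite /Rintegral -!fE//; congr fine.
  rewrite /nu /= /mfrestr /mrestr; congr (lebesgue_stieltjes_measure F _).
  rewrite /D; apply/seteqP; split => t /=; rewrite !in_itv /= => -[h1 h2]; split => //.
  by case/andP : h1.
have loc : locally_integrable [set: R] phi.
  exact: open_integrable_locally openT intf.
have int_phi (y : R) : (@lebesgue_measure R).-integrable `]-oo, y] (EFin \o phi).
  exact: integrableS intf.
have := FTC1Ny int_phi loc.
apply: filterS; first exact: (ae_filter_ringOfSetsType lebesgue_measure).
move=> x dx /andP[x0 x1].
have near_eq : \near x, (fun x0 : R => (\int[lebesgue_measure]_(t in `]-oo, x0]) phi t)%R + G 0) x = G x.
  near=> y; rewrite FE ?subrK//; apply/andP; split.
    by near: y; exact: lt_le_nbhsr.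
  by near: y; exact: lt_le_nbhsl.
have [d1 d2] := dx.
have := @is_deriveD _ _ _ _ _ x 1 _ _ (derivableP d1) (is_derive_cst (G 0) x 1).
rewrite addr0 -derive1E d2 => -[e1 e2]; split.
  exact: near_eq_derivable near_eq e1.
by rewrite -e2; apply/esym/near_eq_derive.
Unshelve. all: by end_near. Qed.

Lemma lipschitz_density (g : R -> R) (L : R) :
  (forall x y, `|g x - g y| <= L * `|x - y|) ->
  exists phi : R -> R,
    [/\ (@lebesgue_measure R).-integrable `[0%R, 1%R] (EFin \o phi),
      g 1 - g 0 = (\int[lebesgue_measure]_(t in `[0%R, 1%R]) phi t)%R &
      {ae (@lebesgue_measure R), forall x, 0 < x < 1 ->
        derivable g x 1 /\ 'D_1 g x = phi x}].
Proof.
move=> gL; pose M := `|L| + 1.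
have M0 : 0 < M by rewrite ltr_wpDl.
have gM x y : x <= y -> `|g y - g x| <= M * (y - x).
  move=> xy; apply: le_trans (gL _ _) _; rewrite ger0_norm ?subr_ge0//.
  by rewrite ler_wpM2r ?subr_ge0// /M (le_trans (ler_norm _))// lerDl.
(* The slopes of [g] lie in [[-M, M]]; this affine change moves them into [[0, 1]], the situation of
   the preceding lemma. *)
pose G x := (2 * M)^-1 * (g x + M * x).
have dG x y : G y - G x = (2 * M)^-1 * ((g y - g x) + M * (y - x)).
  by rewrite /G; ring.
have [||phi [iphi phi01 aephi]] := @lipschitz1_density G.
- move=> x y xy; rewrite -subr_ge0 dG; apply: mulr_ge0.
    by rewrite invr_ge0 mulr_ge0// ltW.
  by have := gM _ _ xy; rewrite ler_norml; lra.
- move=> x y xy; rewrite dG mulrC ler_pdivrMr ?mulr_gt0//.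
  by have := gM _ _ xy; rewrite ler_norml; lra.
have mI : measurable (`[0%R, 1%R]%classic : set (measurableTypeR R)) by exact: measurable_itv.
have i01 : (@lebesgue_measure R).-integrable `[0%R, 1%R] (EFin \o phi).
  exact: integrableS iphi.
have ic : (@lebesgue_measure R).-integrable `[0%R, 1%R] (EFin \o cst M).
  apply: measurable_bounded_integrable => //.
    by rewrite /= lebesgue_measure_itv /= lte_fin ltr01 oppr0 adde0 ltry.
  exact: bounded_cst.
have gE x : g x = 2 * M * G x - M * x.
  by rewrite /G mulrA divff ?mul1r ?mulf_neq0 ?gt_eqF// addrK.
exists (fun x => 2 * M * phi x - M); split.
- have := integrableB mI (integrableZl mI (2 * M) i01) ic.
  by apply: eq_integrable => // x _ /=; rewrite EFinB EFinM.
- rewrite RintegralB//; last first.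
    by have := integrableZl mI (2 * M) i01; apply: eq_integrable => // x _ /=; rewrite EFinM.
  rewrite RintegralZl// -phi01 Rintegral_cst//= lebesgue_measure_itv /= lte_fin ltr01 oppr0 adde0 /=.
  by rewrite !gE; ring.
move: aephi; apply: filterS; first exact: (ae_filter_ringOfSetsType lebesgue_measure).
move=> x /[apply] -[d1 d2].
have -> : g = (fun x => 2 * M * G x) - (fun x => M * x).
  by apply/funext => y; rewrite gE.
have h1 : is_derive x 1 (fun x => 2 * M * G x) (2 * M * phi x).
  have := is_deriveZ (2 * M) (derivableP d1); rewrite d2.
  by [].
have h2 : is_derive x 1 (fun x : R => M * x) M.
  have := is_deriveZ M (is_derive_id x 1); rewrite /GRing.scale /= mulr1.
  by [].
by have [? e2] := is_deriveB h1 h2; split => //; rewrite e2.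
Qed.

(** The bound by [h] is asked only where [g] is derivable, which is almost everywhere; the density
    [phi] supplies a measurable version of the derivative. The values of [h] are extended reals
    because [lipnum] will be used for it. *)
Lemma lipschitz_le_integral_upper (g : R -> R) (L : R) (h : R -> \bar R) :
  (forall x y, `|g x - g y| <= L * `|x - y|) ->
  measurable_fun [set: R] h -> (forall x, 0 <= h x)%E ->
  (forall x, 0 < x < 1 -> derivable g x 1 -> (`|'D_1 g x|%:E <= h x)%E) ->
  (`|g 1 - g 0|%:E <= \int[lebesgue_measure]_(t in `[0%R, 1%R]) h t)%E.
Proof.
move=> gL mh h0 hg.
have [phi [iphi -> aephi]] := lipschitz_density _ _ gL.
have mI : measurable (`[0%R, 1%R]%classic : set R) by exact: measurable_itv.
apply: le_trans (_ : (\int[lebesgue_measure]_(t in `[0%R, 1%R]) `|phi t|%:E <= _)%E).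
  have := le_abse_integral (@lebesgue_measure R) mI (measurable_int _ iphi).
  have Ifin := integrable_fin_num (mI : measurable (_ : set (measurableTypeR R))) iphi.
  by rewrite /Rintegral -fine_abse// fineK// abse_fin_num.
apply: ae_ge0_le_integral => //.
- by apply/measurable_EFinP/measurableT_comp => //; apply/measurable_EFinP; exact: measurable_int iphi.
- exact: measurable_funTS.
have neg1 (y : R) : (@lebesgue_measure R).-negligible [set y].
  by apply/negligibleP; [exact: measurable_set1|exact: lebesgue_measure_set1].
apply: (negligibleS _ (negligibleU aephi (negligibleU (neg1 0) (neg1 1)))).
move=> x /= /not_implyP[]; rewrite in_itv /= => /andP[x0 x1] Hx.
have [->|x0'] := eqVneq x 0; first by right; left.
have [->|x1'] := eqVneq x 1; first by right; right.
left => /= H; apply: Hx.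
have x01 : 0 < x < 1 by rewrite !lt_neqAle x0 x1 x1' eq_sym x0'.
by have [d1 <-] := H x01; exact: hg.
Qed.
End LipschitzLine.

(** * Lebesgue measure on R^n *)

Section AsSigmaFinite.
Context d (T : measurableType d) (R : realType) (m : {measure set T -> \bar R}).

(** Tonelli's theorem expects a sigma-finite structure, whereas [lam] is a bare measure. Carrying
    the proof [sf] as a parameter of this alias lets the structure be inferred. *)
Definition as_sigma_finite (sf : sigma_finite [set: T] m) : set T -> \bar R := m.

Hypothesis sf : sigma_finite [set: T] m.
HB.instance Definition _ := Measure.on (as_sigma_finite sf).
HB.instance Definition _ :=
  Measure_isSigmaFinite.Build _ _ _ (as_sigma_finite sf) sf.
End AsSigmaFinite.

Section BorelRn.
Context {R : realType} {n : nat}.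
Local Notation E := (Rn R n).

Definition box (a b : E) : set E :=
  [set x | forall i, a ord0 i <= x ord0 i <= b ord0 i].

Lemma Rn_norm_le (x : E) (c : R) : 0 <= c ->
  (`|x| <= c) <-> (forall i, `|x ord0 i| <= c).
Proof.
move=> c0; have -> : `|x| = \big[Num.max/0]_ij `|x ij.1 ij.2| := mx_normrE x; split.
  by move=> /bigmax_leP[_ H] i; exact: (H (ord0, i)).
by move=> H; apply/bigmax_leP; split=> // -[i j] _ /=; rewrite ord1.
Qed.

Lemma Rn_coord_le (x : E) i : `|x ord0 i| <= `|x|.
Proof. exact: ((Rn_norm_le x _ (normr_ge0 x)).1 (lexx _)). Qed.

Lemma continuous_coord i : continuous (fun x : E => x ord0 i).
Proof. exact: coord_continuous. Qed.

Lemma open_measurable_Rn (U : set E) : open U -> measurable U.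
Proof. by move=> oU; exact: sub_sigma_algebra. Qed.

Lemma closed_measurable_Rn (U : set E) : closed U -> measurable U.
Proof.
move=> cU; rewrite -[U]setCK; apply: measurableC; apply: open_measurable_Rn.
exact: closed_openC.
Qed.

Lemma continuous_measurable_Rn (f : E -> R) : continuous f -> measurable_fun [set: E] f.
Proof.
move=> /continuousP cf; apply: (measurability _ (RGenOInfty.measurableE R)) => /= _ [_ [a ->] <-].
by rewrite setTI; apply: open_measurable_Rn; apply: cf; exact: interval_open.
Qed.

Lemma measurable_box (a b : E) : measurable (box a b).
Proof.
have -> : box a b = \bigcap_(i in [set: 'I_n])
    ((fun x : E => x ord0 i) @^-1` `[a ord0 i, b ord0 i]%classic).
  apply/seteqP; split => x; first by move=> H i _ /=; rewrite in_itv /= H.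
  by move=> H i; have := H i I; rewrite /= in_itv.
apply: fin_bigcap_measurable => [|i _]; first exact: finite_finset.
rewrite -[X in measurable X]setTI; apply: continuous_measurable_Rn => //.
exact: continuous_coord.
Qed.

Let near_center (x q d : R) : x - d < q < x + d -> q + -1 * d <= x <= q + 1 * d.
Proof. by move=> /andP[? ?]; apply/andP; split; lra. Qed.

Let near_trans (x y q d e : R) : 2 * d < e -> x - d < q < x + d ->
  q + -1 * d <= y <= q + 1 * d -> -e < x - y < e.
Proof. by move=> ? /andP[? ?] /andP[? ?]; apply/andP; split; lra. Qed.

(** The boxes are those with rational centre and half-side [1/(m+1)] that lie inside [U], enumerated
    through [pickle]. When [2/(m+1) < e], such a box containing [x] stays in the ball of radius [e]
    about [x]. *)
Lemma open_bigcup_box (U : set E) : open U ->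
  exists (D : set nat) (a b : nat -> E), U = \bigcup_(k in D) box (a k) (b k).
Proof.
move=> oU.
pose c (q : 'rV[rat]_n * nat) (s : R) : E := \row_i (ratr (q.1 ord0 i) + s * q.2.+1%:R^-1).
pose u k := odflt (0, 0%N) (unpickle k : option ('rV[rat]_n * nat)).
exists [set k | box (c (u k) (-1)) (c (u k) 1) `<=` U].
exists (fun k => c (u k) (-1)), (fun k => c (u k) 1).
apply/seteqP; split => [x Ux|x [k kU]]; last exact: kU.
have /nbhs_ballP[e /= e0 eU] : nbhs x U by exact: open_nbhs_nbhs.
have [m me] : exists m : nat, 2 * m.+1%:R^-1 < e.
  exists (Num.truncn (2 / e)); rewrite ltr_pdivrMr// mulrC -ltr_pdivrMr//.
  by apply: truncnS_gt.
have m0 : 0 < m.+1%:R^-1 :> R by rewrite invr_gt0.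
have /choice[q qx] : forall i : 'I_n, exists q : rat,
    x ord0 i - m.+1%:R^-1 < ratr q < x ord0 i + m.+1%:R^-1.
  move=> i; have [|q] := @rat_in_itvoo R (x ord0 i - m.+1%:R^-1) (x ord0 i + m.+1%:R^-1).
    by rewrite ltrD2l gtrN.
  by rewrite in_itv /=; exists q.
exists (pickle (\row_i q i, m)); last first.
  by move=> i; rewrite /u pickleK /= !mxE /=; exact: near_center.
move=> y; rewrite /u pickleK /= => yb; apply: eU; split => // i j.
rewrite ord1 /ball /= ltr_norml.
have := yb j; rewrite !mxE /=; exact: near_trans.
Qed.

(** The sigma-algebra is generated by open sets and is not given as a product. Countable unions of
    boxes bridge the gap, since the preimage of a box is a finite intersection of coordinate
    conditions. *)
Lemma measurable_fun_Rn d (T : measurableType d) (f : T -> E) :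
  (forall i, measurable_fun [set: T] (fun t => f t ord0 i)) -> measurable_fun [set: T] f.
Proof.
move=> mf; apply: (@measurability _ _ _ _ setT f [set U : set E | open U]) => // _ [U oU <-].
have [D [a [b ->]]] := open_bigcup_box _ oU.
rewrite setTI preimage_bigcup; apply: bigcup_measurable => k _.
have -> : f @^-1` box (a k) (b k) = \bigcap_(i in [set: 'I_n])
    ((fun t => f t ord0 i) @^-1` `[a k ord0 i, b k ord0 i]%classic).
  apply/seteqP; split => x; first by move=> H i _ /=; rewrite in_itv /= H.
  by move=> H i; have := H i I; rewrite /= in_itv.
apply: fin_bigcap_measurable => [|i _]; first exact: finite_finset.
by rewrite -[X in measurable X]setTI; apply: mf.
Qed.

Lemma bigcup_box_setT : \bigcup_k box (const_mx (- k%:R)) (const_mx k%:R) = [set: E].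
Proof.
apply/seteqP; split => // x _; exists (Num.truncn `|x|).+1 => // i.
rewrite !mxE -ler_norml (le_trans (Rn_coord_le x i))// ltW//.
exact: truncnS_gt.
Qed.

(** Boxes form a pi-system (maximum of lower corners, minimum of upper ones) that generates the
    Borel sets, and centred cubes exhaust the space. Translation invariance of [lam] will follow
    from this. *)
Lemma measure_box_unique (m1 m2 : {measure set E -> \bar R}) :
  (forall a b, m1 (box a b) = m2 (box a b)) -> (forall a b, (m1 (box a b) < +oo)%E) ->
  forall A, measurable A -> m1 A = m2 A.
Proof.
move=> m12 moo A mA.
pose G := [set box ab.1 ab.2 | ab in [set: E * E]].
apply: (measure_unique G (fun k => box (const_mx (- k%:R)) (const_mx k%:R))) => //.
- apply/seteqP; split; apply: smallest_sub.
  + exact: smallest_sigma_algebra.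
  + move=> U oU; have [D [c [d ->]]] := open_bigcup_box _ oU.
    apply: (@bigcup_measurable _ (g_sigma_algebraType G)) => k _.
    by apply: sub_sigma_algebra; exists (c k, d k).
  + exact: sigma_algebra_measurable.
  + by move=> _ [[c d] _ <-]; exact: measurable_box.
- move=> _ _ [[a b] _ <-] [[c d] _ <-] /=.
  exists (\row_i Num.max (a ord0 i) (c ord0 i), \row_i Num.min (b ord0 i) (d ord0 i)) => //=.
  apply/seteqP; split => x.
    move=> H; split => i; have := H i; rewrite !mxE ge_max le_min => /andP[/andP[? ?] /andP[? ?]];
      by apply/andP.
  move=> [H1 H2] i; rewrite !mxE ge_max le_min; have /andP[-> ->] := H1 i.
  by have /andP[-> ->] := H2 i.
- by move=> k; exists (const_mx (- k%:R), const_mx k%:R).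
- exact: bigcup_box_setT.
- by move=> _ [[a b] _ <-].
Qed.

Lemma measurable_addr (v : E) : measurable_fun [set: E] (fun x : E => x + v).
Proof.
apply: measurable_fun_Rn => i; under eq_fun do rewrite mxE.
by apply: measurable_funD => //; apply: continuous_measurable_Rn; exact: continuous_coord.
Qed.

Lemma measurable_add2 : measurable_fun [set: E * E] (fun p : E * E => p.1 + p.2).
Proof.
apply: measurable_fun_Rn => i; under eq_fun do rewrite mxE.
have mc := continuous_measurable_Rn _ (continuous_coord i).
by apply: measurable_funD; apply: measurableT_comp mc _.
Qed.

Lemma measurable_line (v : E) :
  measurable_fun [set: E * measurableTypeR R] (fun p => p.1 + (p.2 : R) *: v).
Proof.
apply: measurable_fun_Rn => i; under eq_fun do rewrite !mxE.
have mc := continuous_measurable_Rn _ (continuous_coord i).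
apply: measurable_funD; first exact: measurableT_comp mc _.
by apply: measurable_funM => //.
Qed.

Section Lebesgue.
Variable lam : {measure set E -> \bar R}.
Hypothesis lamE : is_lebesgue_Rn lam.

Lemma lebesgue_box_lty (a b : E) : (lam (box a b) < +oo)%E.
Proof.
have [ab|] := pselect (forall i, a ord0 i <= b ord0 i).
  by rewrite [X in (X < _)%E](lamE _ _ ab) ltry.
move=> nab; suff -> : box a b = set0 by rewrite measure0.
apply/seteqP; split=> // x xab; apply: nab => i.
by have /andP[] := xab i; exact: le_trans.
Qed.

Lemma lebesgue_sigma_finite : sigma_finite [set: E] lam.
Proof.
exists (fun k => box (const_mx (- k%:R)) (const_mx k%:R)); first by rewrite bigcup_box_setT.
by move=> k; split; [exact: measurable_box|exact: lebesgue_box_lty].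
Qed.

Lemma lebesgue_shift (v : E) (A : set E) : measurable A ->
  lam ((fun x => x + v) @^-1` A) = lam A.
Proof.
move=> mA.
have shiftbox a b : (fun x : E => x + v) @^-1` box a b = box (a - v) (b - v).
  apply/seteqP; split => x H i; have := H i; rewrite !mxE.
    by rewrite lerBlDr lerBrDr.
  by rewrite lerBlDr lerBrDr.
have mE a b : pushforward lam (fun x : E => x + v) (box a b) = lam (box a b).
  rewrite /pushforward shiftbox.
  have [ab|nab] := pselect (forall i, a ord0 i <= b ord0 i).
    rewrite [LHS]lamE ?[RHS]lamE//.
      by congr (_%:E); apply: eq_bigr => i _; rewrite !mxE; ring.
    by move=> i; rewrite !mxE lerD2r.
  (* The box formula of [is_lebesgue_Rn] covers ordered corners only; otherwise both boxes are
     empty. *)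
  have -> : box a b = set0.
    apply/seteqP; split=> // x xab; apply: nab => i.
    by have /andP[] := xab i; exact: le_trans.
  suff -> : box (a - v) (b - v) = set0 by [].
  apply/seteqP; split=> // x xab; apply: nab => i.
  have /andP[] := xab i; rewrite !mxE => h1 h2.
  by have := le_trans h1 h2; rewrite lerD2r.
have mf := measurable_addr v.
pose phi : {mfun E >-> E} := HB.pack (fun x : E => x + v) (isMeasurableFun.Build _ _ _ _ _ mf).
apply: (measure_box_unique (pushforward lam phi) lam) => // a b.
by rewrite [X in (X < _)%E]mE; exact: lebesgue_box_lty.
Qed.

Lemma ge0_integral_lebesgue_shift (v : E) (f : E -> \bar R) :
  measurable_fun [set: E] f -> (forall x, 0 <= f x)%E ->
  (\int[lam]_x f (x + v)%R = \int[lam]_x f x)%E.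
Proof.
move=> mf f0.
pose phi : {mfun E >-> E} :=
  HB.pack (fun x : E => x + v) (isMeasurableFun.Build _ _ _ _ _ (measurable_addr v)).
transitivity (\int[pushforward lam phi]_x f x)%E.
  rewrite (ge0_integral_pushforward (measurable_addr v))//.
by apply: (eq_measure_integral lam) => A mA _; exact: lebesgue_shift.
Qed.

(* By translation invariance, [lam B] is the integral over [t] in [0, 1] of
   [lam (B - t v)]; then exchange the two integrals. *)
Lemma lebesgue_null_lines (v : E) (B : set E) : measurable B ->
  (forall x, (@lebesgue_measure R).-negligible (`[0%R, 1%R]%classic `&` [set t : R | B (x + t *: v)])) ->
  lam B = 0%E.
Proof.
move=> mB B0.
pose A : set (E * measurableTypeR R) :=
  (setT `*` `[0%R, 1%R]%classic) `&` ((fun p => p.1 + (p.2 : R) *: v) @^-1` B).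
have mA : measurable A.
  apply: measurableI; first by apply: measurableX => //; exact: measurable_itv.
  by rewrite -[X in measurable X]setTI; exact: measurable_line.
have := @indic_fubini_tonelli _ _ _ _ R
  (as_sigma_finite _ _ _ _ lebesgue_sigma_finite) (@lebesgue_measure R) A mA.
rewrite indic_fubini_tonelli_FE// indic_fubini_tonelli_GE//.
rewrite [LHS]integral0_eq; last first.
  move=> x _ /=; apply: measure_negligible; first exact: measurable_xsection.
  by apply: negligibleS (B0 x) => t; rewrite /xsection /A /= inE /= => -[[]].
rewrite (eq_integral (fun t : measurableTypeR R => (\1_(`[0%R, 1%R]%classic) t)%:E *
  lam B)%E); last first.
  move=> t _ /=; rewrite indicE; have [t01|t01] := boolP (t \in `[0%R, 1%R]%classic) => /=.
    rewrite mul1e -(lebesgue_shift (t *: v) _ mB); congr (lam _).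
    apply/seteqP; split => x; rewrite /ysection /A /= inE /=; first by case.
    by move=> ?; split => //; split => //; rewrite inE in t01.
  rewrite mul0e -(measure0 lam); congr (lam _).
  apply/seteqP; split => // x; rewrite /ysection /A /= inE /= => -[[_ t1]].
  by rewrite notin_setE in t01.
rewrite ge0_integralZr// ?integral_indic ?setIT//=; first last.
- by apply/measurable_EFinP; apply: measurable_indic; exact: measurable_itv.
by rewrite lebesgue_measure_itv /= lte_fin ltr01 oppr0 adde0 mul1e => /esym.
Qed.
End Lebesgue.

End BorelRn.

(** * Rademacher's theorem *)

Section Rademacher.
Context {R : realType} {n : nat}.
Local Notation E := (Rn R n).
Implicit Types (F : E -> R) (x v w p : E).

Definition lipschitz_const (L : R) (F : E -> R) :=
  forall x y, `|F x - F y| <= L * `|x - y|.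

Lemma lipschitz_const_continuous L F : lipschitz_const L F -> continuous F.
Proof.
move=> FL x A /nbhs_ballP[e /= e0 eA].
have M0 : 0 < `|L| + 1 by rewrite ltr_wpDl.
apply/nbhs_ballP; exists (e / (`|L| + 1)); first by rewrite /= divr_gt0.
move=> y; rewrite -ball_normE /= ltr_pdivlMr// mulrC => xy; apply: eA.
rewrite -ball_normE /=; apply: le_lt_trans (FL _ _) (le_lt_trans _ xy).
by rewrite ler_wpM2r// (le_trans (ler_norm _))// lerDl.
Qed.

Definition has_dirderiv F v x := exists p : R, forall e, 0 < e ->
  exists2 d : R, 0 < d & forall s, `|s| < d ->
    `|F (x + s *: v) - F x - p * s| <= e * `|s|.

Let quot F v s x := (F (x + s *: v) - F x) / s.

(** Existence of the directional derivative becomes a Cauchy condition that does not mention the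
    limit. For fixed [s] and [t] the condition is closed in [x], so the set of points of existence
    is a countable intersection of countable unions of closed sets. *)
Let cauchy_quot F v (m k : nat) := [set x | forall s t,
  s != 0 -> t != 0 -> `|s| < k.+1%:R^-1 -> `|t| < k.+1%:R^-1 ->
  `|quot F v s x - quot F v t x| <= m.+1%:R^-1].

Let closed_cauchy_quot F v m k : continuous F -> closed (cauchy_quot F v m k).
Proof.
move=> cF.
have cq s : continuous (quot F v s).
  move=> x; have cshift : {for x, continuous (fun x : E => F (x + s *: v))}.
    apply: (@continuous_comp _ _ _ (fun x : E => x + s *: v) F); last exact: cF.
    by apply: (@continuousD _ _ _ id (cst (s *: v)));
      [by move=> B|exact: cst_continuous].
  apply: (@continuousM _ _ (fun x => F (x + s *: v) - F x) (cst s^-1));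
    last exact: cst_continuous.
  by apply: (@continuousB _ _ _ (fun x => F (x + s *: v)) F) => //; exact: cF.
have -> : cauchy_quot F v m k = \bigcap_(st in [set st : R * R |
    [/\ st.1 != 0, st.2 != 0, `|st.1| < k.+1%:R^-1 & `|st.2| < k.+1%:R^-1]])
    ((fun x => `|quot F v st.1 x - quot F v st.2 x|) @^-1` [set r | r <= m.+1%:R^-1]).
  apply/seteqP; split => x; first by move=> H [s t] /= [? ? ? ?]; exact: H.
  by move=> H s t ? ? ? ?; exact: (H (s, t)).
apply: closed_bigI => -[s t] _; apply: closed_comp; last exact: closed_le.
move=> x _; apply: (@continuous_comp _ _ _ (fun x => quot F v s x - quot F v t x) Num.norm).
  by apply: (@continuousB _ _ _ (quot F v s) (quot F v t)); exact: cq.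
exact: norm_continuous.
Qed.

Let has_dirderivE F v :
  [set x | has_dirderiv F v x] = \bigcap_m \bigcup_k cauchy_quot F v m k.
Proof.
apply/seteqP; split => x.
  move=> [p px] m _; have m0 : 0 < (2 * m.+1%:R)^-1 :> R by rewrite invr_gt0 mulr_gt0.
  have [d d0 pd] := px _ m0.
  have quotP s : s != 0 -> `|s| < d -> `|quot F v s x - p| <= (2 * m.+1%:R)^-1.
    move=> s0 sd; have := pd _ sd; rewrite -ler_pdivrMr ?normr_gt0//.
    by rewrite -normf_div mulrBl mulfK.
  exists (Num.truncn d^-1) => // s t s0 t0 sk tk.
  have kd : (Num.truncn d^-1).+1%:R^-1 < d.
    by rewrite invf_plt ?posrE// truncnS_gt.
  have h1 := quotP _ s0 (lt_trans sk kd); have h2 := quotP _ t0 (lt_trans tk kd).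
  rewrite (_ : _ - _ = (quot F v s x - p) - (quot F v t x - p)); last by ring.
  rewrite (le_trans (ler_normB _ _))// (le_trans (lerD h1 h2))//.
  by rewrite invfM -mulrDl (_ : 2^-1 + 2^-1 = 1 :> R) ?mul1r//; lra.
move=> H.
have ch : cauchy ((fun s => quot F v s x) @ 0^').
  apply/cauchy_ballP => e e0.
  have [k _ xk] := H (Num.truncn e^-1) I.
  have near_k : \forall s \near (0 : R)^', s != 0 /\ `|s| < k.+1%:R^-1.
    near=> s; split; first by near: s; exact: nbhs_dnbhs_neq.
    by near: s; apply: dnbhs0_lt; rewrite invr_gt0.
  exists ([set (quot F v s x) | s in [set s | s != 0 /\ `|s| < k.+1%:R^-1]],
          [set (quot F v s x) | s in [set s | s != 0 /\ `|s| < k.+1%:R^-1]]) => /=.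
    by split; apply: filterS near_k => s sk; exists s.
  move=> [_ _] [/= [s [s0 sk] <-] [t [t0 tk] <-]]; rewrite /ball /=.
  apply: le_lt_trans (xk s t s0 t0 sk tk) _.
  by rewrite invf_plt ?posrE// truncnS_gt.
have /cauchy_cvgP/cvg_ex[p pE] := ch.
exists p => e e0.
have : \forall s \near 0^', `|p - quot F v s x| <= e by move/cvgrPdist_le : pE; exact.
move=> [d /= d0 dP]; exists d => // s sd.
have [->|s0] := eqVneq s 0.
  by rewrite scale0r addr0 subrr mulr0 subr0 normr0 mulr0.
rewrite -ler_pdivrMr ?normr_gt0// -normf_div mulrBl mulfK// distrC.
by apply: dP => //=; rewrite sub0r normrN.
Unshelve. all: by end_near. Qed.

Lemma measurable_has_dirderiv F v : continuous F -> measurable [set x | has_dirderiv F v x].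
Proof.
move=> cF; rewrite has_dirderivE; apply: bigcapT_measurable => m.
by apply: bigcupT_measurable => k; apply: closed_measurable_Rn; exact: closed_cauchy_quot.
Qed.

Lemma derivable_line F v x (t : R) :
  derivable (fun s : R => F (x + s *: v)) t 1 -> has_dirderiv F v (x + t *: v).
Proof.
move=> /cvg_ex[p pE]; exists p => e e0.
have : \forall h \near 0^', `|p - h^-1 *: (F (x + (h *: 1 + t) *: v) - F (x + t *: v))| <= e.
  by move/cvgrPdist_le : pE; exact.
move=> [d /= d0 dP]; exists d => // s sd.
have [->|s0] := eqVneq s 0.
  by rewrite scale0r addr0 subrr mulr0 subr0 normr0 mulr0.
rewrite -ler_pdivrMr ?normr_gt0// -normf_div mulrBl mulfK// distrC.
have := dP s; rewrite /= sub0r normrN => /(_ sd s0).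
rewrite (_ : s%:A = s); last by rewrite /GRing.scale /= mulr1.
by rewrite [s + t]addrC scalerDl addrA [X in `|_ - X|]mulrC.
Qed.

Lemma lipschitz_const_line L F v x : lipschitz_const L F ->
  forall s t : R, `|F (x + s *: v) - F (x + t *: v)| <= L * `|v| * `|s - t|.
Proof.
move=> FL s t; apply: le_trans (FL _ _) _.
by rewrite opprD addrACA subrr add0r -scalerBl normrZ [`|s - t| * _]mulrC mulrA.
Qed.

Section Lebesgue.
Variable lam : {measure set E -> \bar R}.
Hypothesis lamE : is_lebesgue_Rn lam.

(** On each line parallel to [v] the restriction of [F] is Lipschitz, so the exceptional set meets
    [[0, 1]] in a null set; [lebesgue_null_lines] then makes it null in the whole space. *)
Lemma lipschitz_ae_dirderiv L F v : lipschitz_const L F ->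
  lam.-negligible [set x | ~ has_dirderiv F v x].
Proof.
move=> FL; have mD : measurable [set x | ~ has_dirderiv F v x].
  apply: measurableC; apply: measurable_has_dirderiv.
  exact: lipschitz_const_continuous FL.
apply/negligibleP => //; apply: (lebesgue_null_lines lam lamE v) => // x.
have [phi [_ _ aephi]] := lipschitz_density _ _ _ (lipschitz_const_line _ _ v x FL).
have neg1 (y : R) : (@lebesgue_measure R).-negligible [set y].
  by apply/negligibleP; [exact: measurable_set1|exact: lebesgue_measure_set1].
apply: (negligibleS _ (negligibleU aephi (negligibleU (neg1 0) (neg1 1)))).
move=> t /= []; rewrite in_itv /= => /andP[t0 t1] Ht.
have [->|t0'] := eqVneq t 0; first by right; left.
have [->|t1'] := eqVneq t 1; first by right; right.
left => H; apply: Ht.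
have t01 : 0 < t < 1 by rewrite !lt_neqAle t0 t1 t1' eq_sym t0'.
by have [d1 _] := H t01; exact: derivable_line.
Qed.

Let dist_to (A : set E) (x : E) : R := inf [set `|x - y| | y in A].

Let dist_to_ge0 A x : 0 <= dist_to A x.
Proof.
rewrite /dist_to; have [->|/set0P A0] := eqVneq A set0.
  by rewrite image_set0 inf0.
apply: lb_le_inf; first by case: A0 => y Ay; exists `|x - y|; exists y.
by move=> _ [y _ <-].
Qed.

Let dist_to_le A x y : A y -> dist_to A x <= `|x - y|.
Proof.
move=> Ay; apply: ge_inf; last by exists y.
by exists 0 => _ [z _ <-].
Qed.

Let dist_to_approx A x e : A !=set0 -> 0 < e ->
  exists2 y, A y & `|x - y| < dist_to A x + e.
Proof.
move=> [z Az] e0.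
have hi : has_inf [set `|x - y| | y in A].
  by split; [exists `|x - z|; exists z|exists 0 => _ [y _ <-]].
by have [_ [y Ay <-] ?] := inf_adherent e0 hi; exists y.
Qed.

Let dist_to_lipschitz A : A !=set0 -> lipschitz_const 1 (dist_to A).
Proof.
move=> A0 x y; rewrite mul1r.
have H u w : dist_to A u <= dist_to A w + `|u - w|.
  apply/ler_addgt0Pr => e e0; have [z Az zw] := dist_to_approx A w e A0 e0.
  apply: le_trans (dist_to_le A u z Az) _.
  rewrite (_ : u - z = (u - w) + (w - z)); last by rewrite addrA subrK.
  by rewrite (le_trans (ler_normD _ _))//; lra.
by have := H x y; have := H y x; rewrite ler_norml [`|y - x|]distrC => ? ?; apply/andP; split; lra.
Qed.

(* This replaces the Lebesgue density theorem: on A the distance function to A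
   vanishes and is nonnegative, so its directional derivative, where it exists, is 0. *)
Lemma ae_directionally_approximable (A : set E) v :
  lam.-negligible [set x | A x /\ ~ forall e, 0 < e -> exists2 d : R, 0 < d &
    forall s, `|s| < d -> exists2 y, A y & `|x + s *: v - y| <= e * `|s|].
Proof.
have [->|/set0P A0] := eqVneq A set0.
  by apply: negligibleS (negligible_set0 _) => x [].
apply: negligibleS (lipschitz_ae_dirderiv _ _ v (dist_to_lipschitz A A0)).
move=> x /= [Ax nH] [p px]; apply: nH => e e0.
have [d d0 pd] := px (e / 3) (divr_gt0 e0 (ltr0n _ 3)).
have dx : dist_to A x = 0.
  apply/eqP; rewrite eq_le dist_to_ge0 andbT.
  by have := dist_to_le A x x Ax; rewrite subrr normr0.
exists d => // s sd; have [->|s0] := eqVneq s 0.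
  by exists x => //; rewrite scale0r addr0 subrr !normr0 mulr0.
have s0' : 0 < `|s| by rewrite normr_gt0.
(* Adding the expansions at [s] and [-s] cancels [p]. As the distance at [-s] is nonnegative, the
   distance at [s] is at most [2/3 * e * |s|]; the last third pays for the near-minimiser [y]. *)
have h1 := pd _ sd; have h2 : _ <= _ := pd (- s) _; rewrite normrN in h2.
have {}h2 := h2 sd.
have ge1 := dist_to_ge0 A (x + s *: v); have ge2 := dist_to_ge0 A (x + (- s) *: v).
have [y Ay yd] := dist_to_approx A (x + s *: v) _ A0 (divr_gt0 (mulr_gt0 e0 s0') (ltr0n _ 3)).
exists y => //; apply: ltW; apply: lt_le_trans yd _.
move: h1 h2; rewrite dx !subr0 !ler_norml => /andP[_ h1] /andP[_ h2].
by lra.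
Qed.

Definition has_gradient F x p := forall e, 0 < e ->
  exists2 d : R, 0 < d & forall w, `|w| < d ->
    `|F (x + w) - F x - \sum_i p ord0 i * w ord0 i| <= e * `|w|.

Let trunc (j : nat) (w : E) : E := \row_i (if (i < j)%N then w ord0 i else 0).

(** Differentiability tested on increments in the first [j] coordinates only. Rademacher's theorem
    is obtained by induction on [j]. *)
Let has_gradient_upto j F x p := forall e, 0 < e ->
  exists2 d : R, 0 < d & forall w, `|w| < d ->
    `|F (x + trunc j w) - F x - \sum_i p ord0 i * trunc j w ord0 i| <= e * `|w|.

Let trunc_norm j w : `|trunc j w| <= `|w|.
Proof.
apply/Rn_norm_le => // i; rewrite mxE; case: ifP => _; first exact: Rn_coord_le.
by rewrite normr0.
Qed.

Let truncS (i : 'I_n) w : trunc i.+1 w = trunc i w + w ord0 i *: evec R i.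
Proof.
apply/matrixP => a k; rewrite /evec !mxE (ord1 a) eqxx /= ltnS.
have [->|ki] := eqVneq k i; first by rewrite leqnn ltnn mulr1 add0r.
by rewrite mulr0 addr0 ltn_neqAle; have -> : (k != i :> nat) by [].
Qed.

(** One slope [q], one error and one radius are valid at all points of the set, so an expansion at
    [x] can be replaced by one at a nearby point [y]. Rational slopes keep the number of such sets
    countable. *)
Let good_set F (j : nat) (q : 'rV[rat]_n) (m k : nat) : set E :=
  [set x | forall w, `|w| < k.+1%:R^-1 ->
    `|F (x + trunc j w) - F x - \sum_i ratr (q ord0 i) * trunc j w ord0 i|
      <= m.+1%:R^-1 * `|w|].

Let good_set_cover F j x p m : has_gradient_upto j F x p ->
  exists q k, good_set F j q m k x /\
    forall w, `|\sum_i (ratr (q ord0 i) - p ord0 i) * trunc j w ord0 i| <= m.+1%:R^-1 * `|w|.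
Proof.
move=> px; have m0 : 0 < m.+1%:R^-1 :> R by rewrite invr_gt0.
pose h : R := m.+1%:R^-1 / 2; have h0 : 0 < h by rewrite divr_gt0.
(* Approximating each coordinate of [p] within [h'] costs at most [n * h' <= h] in the linear form.
   The successor avoids a division by 0 when [n = 0]. *)
pose h' : R := h / n.+1%:R; have h'0 : 0 < h' by rewrite divr_gt0.
have /choice[q qx] : forall i : 'I_n, exists q : rat, p ord0 i - h' < ratr q < p ord0 i + h'.
  move=> i; have [|q] := @rat_in_itvoo R (p ord0 i - h') (p ord0 i + h').
    by rewrite ltrD2l gtrN.
  by rewrite in_itv /=; exists q.
have sumle w : `|\sum_i (ratr (q i) - p ord0 i) * trunc j w ord0 i| <= h * `|w|.
  apply: le_trans (ler_norm_sum _ _ _) _.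
  apply: (@le_trans _ _ (\sum_(i < n) h' * `|w|)).
    apply: ler_sum => i _; rewrite normrM ler_pM//.
      by rewrite ler_norml; have /andP[? ?] := qx i; apply/andP; split; lra.
    by apply: le_trans (Rn_coord_le _ i) (trunc_norm _ _).
  rewrite sumr_const card_ord -mulr_natl mulrA ler_wpM2r//.
  rewrite /h' mulrC -mulrA -[leRHS]mulr1 ler_wpM2l ?ltW//.
  by rewrite mulrC ltr_pdivrMr// mul1r ltr_nat.
have [d d0 pd] := px _ h0.
exists (\row_i q i), (Num.truncn d^-1); split; last first.
  move=> w; under eq_bigr do rewrite mxE; apply: le_trans (sumle w) _.
  by rewrite ler_wpM2r// /h ler_pdivrMr// ler_peMr ?ltW// ltr1n.
move=> w wk; under eq_bigr do rewrite mxE.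
have wd : `|w| < d by apply: lt_trans wk _; rewrite invf_plt ?posrE// truncnS_gt.
rewrite (_ : _ - _ = (F (x + trunc j w) - F x - \sum_i p ord0 i * trunc j w ord0 i) -
  \sum_i (ratr (q i) - p ord0 i) * trunc j w ord0 i); last first.
  by under [X in _ = _ - X]eq_bigr do rewrite mulrBl; rewrite sumrB; ring.
apply: le_trans (ler_normB _ _) _; rewrite (le_trans (lerD (pd _ wd) (sumle w)))//.
by rewrite -mulrDl /h -splitr.
Qed.

(* For [w] in the first [i] coordinates, [F (x + w + s e_i)] is compared with [F (y + w)]
   for a point [y] of the good set within [e |s|] of [x + s e_i]. *)
Let has_gradient_step L F (i : 'I_n) x p r : lipschitz_const L F ->
  has_gradient_upto i F x p ->
  (forall e, 0 < e -> exists2 d : R, 0 < d & forall s, `|s| < d ->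
    `|F (x + s *: evec R i) - F x - r * s| <= e * `|s|) ->
  (forall q m k, good_set F i q m k x -> forall e, 0 < e -> exists2 d : R, 0 < d &
    forall s, `|s| < d -> exists2 y, good_set F i q m k y &
      `|x + s *: evec R i - y| <= e * `|s|) ->
  has_gradient_upto i.+1 F x (\row_k if k == i then r else p ord0 k).
Proof.
move=> FL px rx gx e e0.
(* Five errors of size [h * |w|] add up: replacing [x + s e_i] by [y] with and without the increment
   ([E1], [E2]), the expansion at [y] ([E3]), the directional derivative at [x] ([E4]), and [q]
   against [p] ([E5]). *)
have [m me] : exists m : nat, 5 * m.+1%:R^-1 < e.
  exists (Num.truncn (5 / e)); rewrite ltr_pdivrMr// mulrC -ltr_pdivrMr//.
  exact: truncnS_gt.
set h : R := m.+1%:R^-1 in me; have h0 : 0 < h by rewrite invr_gt0.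
have L0 : 0 < `|L| + 1 by rewrite ltr_wpDl.
have [q [k [xg qp]]] := good_set_cover F i x p m px.
have [d2 d20 H2] := gx _ _ _ xg _ (divr_gt0 h0 L0).
have [d3 d30 H3] := rx _ h0.
have k0 : 0 < k.+1%:R^-1 :> R by rewrite invr_gt0.
exists (Num.min k.+1%:R^-1 (Num.min d2 d3)); first by rewrite !lt_min k0 d20.
move=> w; rewrite !lt_min => /andP[wk /andP[wd2 wd3]].
have sw := Rn_coord_le w i; set s := w ord0 i in sw *.
have [y yg xy] := H2 _ (le_lt_trans sw wd2).
have Fy (u : E) : `|F (u + x + s *: evec R i) - F (u + y)| <= h * `|w|.
  apply: le_trans (FL _ _) _.
  rewrite (_ : _ - _ = x + s *: evec R i - y); last first.
    by rewrite -[u + x + _]addrA opprD addrACA subrr add0r.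
  apply: (@le_trans _ _ ((`|L| + 1) * `|x + s *: evec R i - y|)).
    by rewrite ler_wpM2r// (le_trans (ler_norm _))// lerDl.
  apply: (@le_trans _ _ ((`|L| + 1) * (h / (`|L| + 1) * `|s|))).
    by rewrite ler_wpM2l// ltW.
  by rewrite mulrA mulrCA divff ?gt_eqF// mulr1 ler_wpM2l// ltW.
have sumE : \sum_k0 (\row_k (if k == i then r else p ord0 k)) ord0 k0 * trunc i.+1 w ord0 k0 =
    r * s + \sum_k0 p ord0 k0 * trunc i w ord0 k0.
  rewrite (bigD1 i)//= [in RHS](bigD1 i)//= !mxE eqxx ltnSn ltnn mulr0 add0r; congr (_ + _).
  apply: eq_bigr => k1 k1i; rewrite !mxE (negbTE k1i) ltnS leq_eqVlt.
  by have -> : (k1 == i :> nat) = false by apply/negbTE.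
rewrite sumE truncS.
have E1 := Fy (trunc i w); have E2 := Fy 0; rewrite !add0r in E2.
have E3 := yg w wk; have E4 := H3 _ (le_lt_trans sw wd3); have E5 := qp w.
have E4' : `|F (x + s *: evec R i) - F x - r * s| <= h * `|w|.
  by apply: le_trans E4 _; rewrite ler_wpM2l// ltW.
rewrite (_ : x + (trunc i w + s *: evec R i) = trunc i w + x + s *: evec R i); last first.
  by rewrite addrA [x + _]addrC.
have sumB : \sum_k0 (ratr (q ord0 k0) - p ord0 k0) * trunc i w ord0 k0 =
   \sum_k0 ratr (q ord0 k0) * trunc i w ord0 k0 - \sum_k0 p ord0 k0 * trunc i w ord0 k0.
  by under eq_bigr do rewrite mulrBl; rewrite sumrB.
rewrite sumB in E5; rewrite [trunc i w + y]addrC in E1.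
apply: (@le_trans _ _ (5 * h * `|w|)); last by rewrite ler_wpM2r// ltW.
move: E1 E2 E3 E4' E5; rewrite -/h !ler_norml => /andP[? ?] /andP[? ?] /andP[? ?] /andP[? ?] /andP[? ?].
by apply/andP; split; lra.
Qed.

Let ae_has_gradient_upto L F j : lipschitz_const L F -> (j <= n)%N ->
  lam.-negligible [set x | ~ exists p, has_gradient_upto j F x p].
Proof.
move=> FL; elim: j => [_|j IH jn].
  apply: negligibleS (negligible_set0 _) => x /=; apply.
  exists 0 => e e0; exists 1 => // w _.
  have -> : trunc 0 w = 0 by apply/matrixP => a b; rewrite !mxE.
  rewrite addr0 subrr sub0r normrN big1 ?normr0 ?mulr_ge0// ?ltW//.
  by move=> i _; rewrite mxE mul0r.
pose i := Ordinal jn; have ji : j = i by [].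
(* The good set used at [x] depends on [x] and on [e], so all of them are controlled at once. They
   are countably many, hence the union of their exceptional sets is null. *)
pose bad (u : 'rV[rat]_n * nat * nat) := [set x | good_set F i u.1.1 u.1.2 u.2 x /\
  ~ forall e, 0 < e -> exists2 d : R, 0 < d & forall s, `|s| < d ->
    exists2 y, good_set F i u.1.1 u.1.2 u.2 y & `|x + s *: evec R i - y| <= e * `|s|].
have nbad : lam.-negligible (\bigcup_k bad (odflt (0, 0%N, 0%N) (unpickle k))).
  by apply: negligible_bigcup => k; exact: ae_directionally_approximable.
apply: (negligibleS _ (negligibleU (IH (ltnW jn))
  (negligibleU (lipschitz_ae_dirderiv _ _ (evec R i) FL) nbad))).
move=> x /= nx; apply: contrapT => /not_orP[/contrapT[p px] /not_orP[/contrapT[r rx] nb]].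
apply: nx; exists (\row_k if k == i then r else p ord0 k).
apply: (has_gradient_step L F i x p r FL px rx) => q m k gx.
apply: contrapT => H; apply: nb; exists (pickle (q, m, k)) => //.
by rewrite pickleK /=.
Qed.

Theorem rademacher L F : lipschitz_const L F ->
  lam.-negligible [set x | ~ exists p, has_gradient F x p].
Proof.
move=> FL; apply: negligibleS (ae_has_gradient_upto _ _ _ FL (leqnn n)) => x /= nx [p px].
apply: nx; exists p => e e0; have [d d0 pd] := px e e0; exists d => // w wd.
have := pd w wd; suff -> : trunc n w = w by [].
by apply/matrixP => a b; rewrite !mxE (ord1 a) ltn_ord.
Qed.

End Lebesgue.

Lemma has_gradient_differentiable F x p : has_gradient F x p ->
  differentiable F x /\ forall i, partial i F x = p ord0 i.
Proof.
move=> Fp.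
pose dF0 := fun w : E => \sum_i p ord0 i * w ord0 i.
have lin : linear dF0.
  move=> a u w; rewrite /dF0 scaler_sumr -big_split /=; apply: eq_bigr => i _.
  by rewrite !mxE mulrDr mulrCA.
pose dF : {linear E -> R} := HB.pack dF0 (GRing.isLinear.Build _ _ _ _ _ lin).
have dF0B u w : dF0 u - dF0 w = dF0 (u - w).
  by rewrite /dF0 -sumrB; apply: eq_bigr => i _; rewrite !mxE mulrBr.
have dFE w : dF w = \sum_i p ord0 i * w ord0 i by [].
have cdF : continuous dF.
  move=> u A /nbhs_ballP[e /= e0 eA].
  pose M := 1 + \sum_i `|p ord0 i|.
  have M0 : 0 < M by rewrite ltr_pwDl// sumr_ge0.
  apply/nbhs_ballP; exists (e / M); first by rewrite /= divr_gt0.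
  move=> w; rewrite -ball_normE /= ltr_pdivlMr// mulrC => uw; apply: eA.
  rewrite -ball_normE /= dF0B; apply: le_lt_trans uw.
  rewrite /dF0 (le_trans (ler_norm_sum _ _ _))//.
  apply: (@le_trans _ _ (\sum_i `|p ord0 i| * `|u - w|)).
    by apply: ler_sum => i _; rewrite normrM ler_wpM2l// Rn_coord_le.
  by rewrite -mulr_suml ler_wpM2r// /M lerDr.
have oF : F \o shift x = cst (F x) + dF +o_ (0 : E) id.
  apply/eqaddoP => e e0; have [d d0 H] := Fp _ e0.
  apply/nbhs_ballP; exists d => //= w; rewrite -ball_normE /= sub0r normrN => wd.
  have -> : (F \o shift x - (cst (F x) + dF)) w = F (x + w) - F x - dF0 w.
    transitivity (F (w + x) - (F x + dF0 w)); first by [].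
    by rewrite [w + x]addrC opprD addrA.
  exact: H.
have dE := diff_unique cdF oF.
have dFx : differentiable F x.
  by apply/diff_locallyP; rewrite dE.
split=> // i; rewrite /partial deriveE// dE dFE (bigD1 i)//= big1 ?addr0.
  by rewrite /evec mxE !eqxx mulr1.
by move=> k ki; rewrite /evec mxE (negbTE ki) andbF mulr0.
Qed.

End Rademacher.

(** * Truncation and functions of small support *)

Section Energy.
Context {R : realType} {n : nat}.
Local Notation E := (Rn R n).
Implicit Types (f F G : E -> R) (x w p : E).

Lemma differentiable_has_gradient F x : differentiable F x ->
  has_gradient F x (\row_i partial i F x).
Proof.
move=> dF e e0; have /diff_locallyP[_ /eqaddoP oF] := dF.
have /nbhs_ballP[d /= d0 H] := oF _ e0.
exists d => // w wd; have := H w; rewrite -ball_normE /= sub0r normrN => /(_ wd).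
have -> : (F \o shift x - (cst (F x) + 'd F x)) w = F (x + w) - F x - 'd F x w.
  transitivity (F (w + x) - (F x + 'd F x w)); first by [].
  by rewrite [w + x]addrC opprD addrA.
suff -> : 'd F x w = \sum_i (\row_i partial i F x) ord0 i * w ord0 i by [].
have wE : w = \sum_i w ord0 i *: evec R i.
  by rewrite [LHS]row_sum_delta.
rewrite [in LHS]wE linear_sum; apply: eq_bigr => i _.
by rewrite linearZ mxE /partial deriveE// mulrC.
Qed.

Lemma has_gradient_local F G x p :
  (exists2 d : R, 0 < d & forall w, `|w| < d -> G (x + w) - G x = F (x + w) - F x) ->
  has_gradient F x p -> has_gradient G x p.
Proof.
move=> [d d0 H] Fp e e0; have [d' d'0 H'] := Fp e e0.
exists (Num.min d d'); first by rewrite lt_min d0.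
by move=> w; rewrite lt_min => /andP[wd wd']; rewrite H// H'.
Qed.

(** Increments [s e_i] and [-s e_i] at a local minimum give [|p_i| <= e] for every [e > 0]. *)
Lemma has_gradient_min G x p :
  (exists2 d : R, 0 < d & forall w, `|w| < d -> G x <= G (x + w)) ->
  has_gradient G x p -> p = 0.
Proof.
move=> [d d0 H] Gp; apply/matrixP => a i; rewrite (ord1 a) [RHS]mxE.
apply/eqP; rewrite -normr_le0; apply/ler_addgt0Pr => e e0; rewrite add0r.
have [d' d'0 H'] := Gp e e0.
have main (s : R) : `|s| < Num.min d d' -> - (p ord0 i * s) <= e * `|s|.
  rewrite lt_min => /andP[sd sd'].
  have nw : `|s *: evec R i| <= `|s|.
    apply/Rn_norm_le => // k; rewrite !mxE; case: (_ && _); first by rewrite mulr1.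
    by rewrite mulr0 normr0.
  have := H' _ (le_lt_trans nw sd'); rewrite (bigD1 i)//= big1; last first.
    by move=> k ki; rewrite !mxE (negbTE ki) andbF !mulr0.
  rewrite !mxE !eqxx mulr1 addr0 ler_norml => /andP[_ h].
  have := H _ (le_lt_trans nw sd); rewrite -subr_ge0 => h2.
  have : e * `|s *: evec R i| <= e * `|s| by rewrite ler_wpM2l// ltW.
  by lra.
pose s := Num.min d d' / 2.
have m0 : 0 < Num.min d d' by rewrite lt_min d0.
have s0 : 0 < s by rewrite divr_gt0.
have sm : `|s| < Num.min d d' by rewrite gtr0_norm// /s gtr_pMr// invf_lt1// ltr1n.
have := main s sm; have := main (- s); rewrite normrN => /(_ sm).
rewrite gtr0_norm// mulrN opprK => h1 h2.
rewrite ler_norml; apply/andP; split; rewrite -(ler_pM2r s0) ?mulNr; lra.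
Qed.

Lemma gradnorm_has_gradient F x p : has_gradient F x p ->
  gradnorm F x = Num.sqrt (\sum_i (p ord0 i) ^+ 2).
Proof.
move=> /has_gradient_differentiable[dF pE]; rewrite /gradnorm asboolT//.
by congr Num.sqrt; apply: eq_bigr => i _; rewrite pE.
Qed.

Lemma gradnorm_ge0 F x : 0 <= gradnorm F x.
Proof. by rewrite /gradnorm; case: ifP => // _; exact: sqrtr_ge0. Qed.

Lemma le_gradnorm_coord F x p i : has_gradient F x p -> `|p ord0 i| <= gradnorm F x.
Proof.
move=> /gradnorm_has_gradient ->; rewrite -sqrtr_sqr ler_wsqrtr// (bigD1 i)//=.
by rewrite lerDl sumr_ge0// => k _; rewrite sqr_ge0.
Qed.

Lemma locally_lipschitzP f : locally_lipschitz f <->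
  forall x, exists2 r : R, 0 < r & exists k : R, forall y z, `|x - y| < r -> `|x - z| < r ->
    `|f y - f z| <= k * `|y - z|.
Proof.
split=> H x; have [r r0 Hr] := H x; exists r => //.
  have [k [_ /(_ (k + 1))]] := Hr; rewrite ltrDl ltr01 => /(_ isT) Hk.
  exists (k + 1) => y z xy xz; apply: (Hk (y, z)); split; by rewrite /= -ball_normE.
have [k Hk] := Hr; exists k; split; first by rewrite num_real.
move=> M kM [y z] /= [xy xz]; rewrite -ball_normE /= in xy; rewrite -ball_normE /= in xz.
by apply: le_trans (Hk _ _ xy xz) _; rewrite ler_wpM2r// ltW.
Qed.

Lemma locally_lipschitz_continuous f : locally_lipschitz f -> continuous f.
Proof.
move=> /locally_lipschitzP fL x A /nbhs_ballP[e /= e0 eA].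
have [r r0 [k Hk]] := fL x.
have M0 : 0 < `|k| + 1 by rewrite ltr_wpDl.
apply/nbhs_ballP; exists (Num.min r (e / (`|k| + 1))); first by rewrite /= lt_min r0 divr_gt0.
move=> y; rewrite -ball_normE /= lt_min ltr_pdivlMr// mulrC => /andP[xr xy]; apply: eA.
rewrite -ball_normE /=; apply: le_lt_trans xy.
apply: le_trans (Hk _ _ _ xr) _; first by rewrite subrr normr0.
by rewrite ler_wpM2r// (le_trans (ler_norm _))// lerDl.
Qed.

Definition trunc_above (t : R) f x := Num.max (f x - t) 0.

Lemma trunc_above_ge0 t f x : 0 <= trunc_above t f x.
Proof. by rewrite /trunc_above le_max lexx orbT. Qed.

Lemma trunc_above_dist t f x y :
  `|trunc_above t f x - trunc_above t f y| <= `|f x - f y|.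
Proof.
rewrite /trunc_above -[f x - f y](_ : (f x - t) - (f y - t) = _); last by ring.
move: (f x - t) (f y - t) => a b.
by case: (leP a 0) => ha; case: (leP b 0) => hb;
  rewrite ?subrr ?normr0// ?sub0r ?subr0 ?normrN ler_norml;
  have := ler_norm (a - b); have := lerNnormlW (lexx `|a - b|); rewrite ?(gtr0_norm hb) ?(gtr0_norm ha);
  try (move=> *; apply/andP; split); lra.
Qed.

Lemma trunc_above_locally_lipschitz t f : locally_lipschitz f ->
  locally_lipschitz (trunc_above t f).
Proof.
move=> /locally_lipschitzP fL; apply/locally_lipschitzP => x.
have [r r0 [k Hk]] := fL x; exists r => //; exists k => y z xy xz.
exact: le_trans (trunc_above_dist _ _ _ _) (Hk _ _ xy xz).
Qed.

(* Where f <= t the truncation has a minimum, so its gradient vanishes wherever it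
   exists; no almost-everywhere differentiability is involved. *)
Lemma gradnorm_trunc_above t f x : continuous f ->
  gradnorm (trunc_above t f) x <= gradnorm f x.
Proof.
move=> cf; rewrite {1}/gradnorm; case: asboolP => [dg|_]; last exact: gradnorm_ge0.
have gp := differentiable_has_gradient _ _ dg; set p := \row_i _ in gp.
have -> : \sum_i (partial i (trunc_above t f) x) ^+ 2 = \sum_i (p ord0 i) ^+ 2.
  by apply: eq_bigr => i _; rewrite /p mxE.
have [fx|fx] := leP (f x) t.
  have -> : p = 0.
    apply: has_gradient_min gp; exists 1 => // w _.
    rewrite {1}/trunc_above (max_r (_ : f x - t <= 0)) ?subr_le0//.
    exact: trunc_above_ge0.
  rewrite big1 ?sqrtr0 ?gradnorm_ge0// => i _.
  by rewrite mxE expr0n.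
rewrite -(gradnorm_has_gradient f x p)//.
apply: has_gradient_local gp.
have : nbhs (f x) [set y | t < y] by exact: lt_nbhsr.
move=> /cf /nbhs_ballP[d /= d0 H]; exists d => // w wd.
have fxw : t < f (x + w).
  by apply: H; rewrite -ball_normE /= opprD addrA subrr add0r normrN.
by rewrite /trunc_above !max_l ?subr_ge0 ?ltW//; ring.
Qed.

End Energy.

Section LowerIntegral.
Context d (T : measurableType d) (R : realType) (mu : {measure set T -> \bar R}).

(** For a nonnegative function the integral is by definition a supremum over the simple functions
    below it, so it is monotone for arbitrary functions. This is the tool for energies, where the
    integrand is [gradnorm f] squared. *)
Lemma ge0_le_lower_integral (f g : T -> \bar R) :
  (forall x, 0 <= f x)%E -> (forall x, f x <= g x)%E ->
  (\int[mu]_x f x <= \int[mu]_x g x)%E.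
Proof.
move=> f0 fg; have g0 x : (0 <= g x)%E by exact: le_trans (f0 x) (fg x).
rewrite !ge0_integralTE//; apply: ereal_sup_le => _ [h hf <-].
exists h => // x; exact: le_trans (hf x) (fg x).
Qed.

End LowerIntegral.

(** * The super Poincare inequality for truncated test functions *)

Section SmallSupport.
Context {R : realType} {n : nat}.
Local Notation E := (Rn R n).
Variable mu : probability E R.
Implicit Types (f g : E -> R).

Let energy f := (\int[mu]_x ((gradnorm f x) ^+ 2)%:E)%E.

Let energy_ge0 f : (0 <= energy f)%E.
Proof. by apply: integral_ge0 => x _; rewrite lee_fin sqr_ge0. Qed.

Let integral_one : (\int[mu]_(x in setT) (cst 1 x) = 1)%E.
Proof. by rewrite integral_cst// mul1e; exact: probability_setT. Qed.

Lemma integral_sqr_le1 g : measurable_fun [set: E] g -> (forall x, 0 <= g x <= 1) ->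
  (\int[mu]_x ((g x) ^+ 2)%:E <= 1)%E.
Proof.
move=> mg g01; rewrite -integral_one.
apply: ge0_le_lower_integral => x; first by rewrite lee_fin sqr_ge0.
by rewrite lee_fin; have /andP[g0 g1] := g01 x; rewrite expr_le1.
Qed.

(* Integrating [2 t g <= t^2 1_(g != 0) + g^2] for [t = (\int g) / m]. *)
Lemma sqr_integral_le_support g (m : R) : measurable_fun [set: E] g ->
  (forall x, 0 <= g x <= 1) -> 0 < m -> (mu [set x | g x != 0%R] <= m%:E)%E ->
  ((\int[mu]_x `|g x|%:E) * (\int[mu]_x `|g x|%:E) <=
    m%:E * \int[mu]_x ((g x) ^+ 2)%:E)%E.
Proof.
move=> mg g01 m0 mum.
have g0 x : 0 <= g x by have /andP[] := g01 x.
have mP : measurable [set x | g x != 0].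
  rewrite (_ : [set x | _] = ~` (g @^-1` [set 0])); last first.
    by apply/seteqP; split => x /eqP.
  by apply: measurableC; rewrite -[X in measurable X]setTI; exact: mg.
have mg2 : measurable_fun [set: E] (fun x => ((g x) ^+ 2)%:E).
  by apply/measurable_EFinP; exact: measurable_funX.
have mg1 : measurable_fun [set: E] (EFin \o g) by apply/measurable_EFinP.
set Y := (\int[mu]_x ((g x) ^+ 2)%:E)%E.
have Y0 : (0 <= Y)%E by apply: integral_ge0 => x _; rewrite lee_fin sqr_ge0.
have Y1 : (Y <= 1)%E by exact: integral_sqr_le1.
have Yfin : Y \is a fin_num by rewrite ge0_fin_numE// (le_lt_trans Y1)// ltry.
have -> : (\int[mu]_x `|g x|%:E = \int[mu]_x (g x)%:E)%E.
  by apply: eq_integral => x _; rewrite ger0_norm.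
set X := (\int[mu]_x (g x)%:E)%E.
have X0 : (0 <= X)%E by apply: integral_ge0 => x _; rewrite lee_fin.
have X1 : (X <= 1)%E.
  rewrite -integral_one.
  by apply: ge0_le_lower_integral => x; rewrite lee_fin//; have /andP[] := g01 x.
have Xfin : X \is a fin_num by rewrite ge0_fin_numE// (le_lt_trans X1)// ltry.
have key (t : R) : 0 <= t -> ((2 * t)%:E * X <= (t ^+ 2 * m)%:E + Y)%E.
  move=> t0; rewrite -ge0_integralZl//; last 2 first.
  - by move=> x _; rewrite lee_fin.
  - by rewrite lee_fin mulr_ge0.
  apply: (@le_trans _ _ (\int[mu]_x ((t ^+ 2)%:E * (\1_[set x | g x != 0%R] x)%:E + ((g x) ^+ 2)%:E))%E).
    apply: ge0_le_lower_integral => x; rewrite -!EFinM -?EFinD lee_fin.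
      by rewrite !mulr_ge0.
    rewrite indicE; have [gx|/negPn gx] := boolP (g x != 0).
      rewrite mem_set//= mulr1 -subr_ge0.
      by rewrite (_ : _ - _ = (t - g x) ^+ 2) ?sqr_ge0//; ring.
    by rewrite (eqP gx) mulr0 expr0n addr0 mulr_ge0// sqr_ge0.
  rewrite ge0_integralD//; last 3 first.
  - by move=> x _; rewrite -EFinM lee_fin mulr_ge0// sqr_ge0.
  - apply: measurable_funeM; apply/measurable_EFinP; exact: measurable_indic.
  - by move=> x _; rewrite lee_fin sqr_ge0.
  rewrite ge0_integralZl//; last 2 first.
  - by apply/measurable_EFinP; exact: measurable_indic.
  - by rewrite lee_fin sqr_ge0.
  rewrite integral_indic// setIT leeD2r// [X in (_ <= X)%E]EFinM lee_wpmul2l//.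
  by rewrite lee_fin sqr_ge0.
have := key (fine X / m); rewrite divr_ge0 ?fine_ge0 ?(ltW m0)// => /(_ isT).
rewrite -(fineK Xfin) -(fineK Yfin) -!EFinM -EFinD !lee_fin /= => h.
rewrite [m * _]mulrC -ler_pdivrMr//.
have e1 : 2 * (fine X / m) * fine X = 2 * (fine X * fine X / m) by ring.
have e2 : (fine X / m) ^+ 2 * m = fine X * fine X / m.
  by rewrite expr2; field; rewrite gt_eqF.
by move: h; rewrite e1 e2; lra.
Qed.

Lemma trunc_above_admissible f (t : R) : 0 <= t -> (forall x, f x <= 1) ->
  admissible mu f -> admissible mu (trunc_above t f).
Proof.
move=> t0 f1 [fL [f2 fE]].
have cg := locally_lipschitz_continuous _ (trunc_above_locally_lipschitz t f fL).
split; first exact: trunc_above_locally_lipschitz.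
split.
  apply: (@le_lt_trans _ _ 1%E); last exact: ltry.
  apply: integral_sqr_le1; first exact: continuous_measurable_Rn.
  move=> x; rewrite trunc_above_ge0 /trunc_above ge_max ler01 andbT.
  by have := f1 x; lra.
apply: le_lt_trans fE; apply: ge0_le_lower_integral => x; rewrite lee_fin ?sqr_ge0//.
rewrite ler_sqr ?nnegrE ?gradnorm_ge0// gradnorm_trunc_above//.
exact: locally_lipschitz_continuous.
Qed.

Lemma SPI_small_support r0 beta (r eps eta m : R) f (A : set E) :
  partial_SPI mu r0 beta -> r0 < r -> 0 < r -> admissible mu f -> (forall x, f x <= 1) ->
  0 <= eps < 1 -> eta < 1 -> 0 < m -> Num.max (beta r) 0 * m <= eta ->
  (mu [set x | (eps < f x)%R] <= m%:E)%E -> measurable A -> (forall x, A x -> 1 <= f x) ->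
  (((1 - eta) * (1 - eps) ^+ 2)%:E * mu A <=
    r%:E * \int[mu]_x ((gradnorm f x) ^+ 2)%:E)%E.
Proof.
move=> spi r0r rgt0 fadm f1 /andP[e0 e1] eta1 m0 bm mum mA fA.
have [fL [_ fE]] := fadm.
pose g := trunc_above eps f.
have gadm : admissible mu g by exact: trunc_above_admissible.
have cf := locally_lipschitz_continuous _ fL.
have mg : measurable_fun [set: E] g.
  by apply: continuous_measurable_Rn; apply: locally_lipschitz_continuous; case: gadm.
have g01 x : 0 <= g x <= 1.
  rewrite trunc_above_ge0 /g /trunc_above ge_max ler01 andbT.
  by have := f1 x; lra.
have mug : (mu [set x | g x != 0%R] <= m%:E)%E.
  apply: le_trans mum; rewrite le_eqVlt; apply/orP; left; apply/eqP; congr (mu _).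
  apply/seteqP; split => x /=; rewrite /g /trunc_above.
    have [h|//] := leP (f x) eps; by rewrite max_r ?subr_le0// eqxx.
  by move=> h; rewrite max_l ?subr_ge0 ?ltW// gt_eqF// subr_gt0.
have CS := sqr_integral_le_support g m mg g01 m0 mug.
have := spi r r0r g gadm.
set Y := (\int[mu]_x ((g x) ^+ 2)%:E)%E in CS *.
set X := (\int[mu]_x `|g x|%:E)%E in CS *.
have Y0 : (0 <= Y)%E by apply: integral_ge0 => x _; rewrite lee_fin sqr_ge0.
have Y1 : (Y <= 1)%E by exact: integral_sqr_le1.
have Yfin : Y \is a fin_num by rewrite ge0_fin_numE// (le_lt_trans Y1)// ltry.
have X0 : (0 <= X)%E by apply: integral_ge0 => x _; rewrite lee_fin.
have Efin : energy f \is a fin_num by rewrite ge0_fin_numE// energy_ge0.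
have Eg : (energy g <= energy f)%E.
  apply: ge0_le_lower_integral => x; rewrite lee_fin ?sqr_ge0//.
  by rewrite ler_sqr ?nnegrE ?gradnorm_ge0// gradnorm_trunc_above.
move=> H.
(* [beta r] may be negative, so its positive part is used to keep the products monotone. Finiteness
   of [Y] is what later permits subtracting [eta * Y]. *)
have H2 : (Y <= r%:E * energy f + eta%:E * Y)%E.
  apply: le_trans H _; apply: leeD; first by rewrite lee_wpmul2l// lee_fin ltW.
  apply: (@le_trans _ _ ((Num.max (beta r) 0)%:E * (X * X))%E).
    by rewrite lee_wpmul2r ?mule_ge0// lee_fin le_max lexx.
  apply: (@le_trans _ _ ((Num.max (beta r) 0)%:E * (m%:E * Y))%E).
    by rewrite lee_wpmul2l// lee_fin le_max lexx orbT.
  by rewrite muleA -EFinM lee_wpmul2r// lee_fin.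
have YA : (((1 - eps) ^+ 2)%:E * mu A <= Y)%E.
  have -> : mu A = (\int[mu]_x (\1_A x)%:E)%E by rewrite integral_indic// setIT.
  rewrite -ge0_integralZl//; last 2 first.
  - by apply/measurable_EFinP; exact: measurable_indic.
  - by rewrite lee_fin sqr_ge0.
  apply: ge0_le_lower_integral => x; rewrite -EFinM lee_fin; first by rewrite mulr_ge0 ?sqr_ge0.
  rewrite indicE; have [xA|xA] := boolP (x \in A); last by rewrite mulr0 sqr_ge0.
  have gx0 : 0 <= g x by exact: trunc_above_ge0.
  rewrite inE in xA; rewrite mulr1 ler_sqr ?nnegrE ?subr_ge0 ?(ltW e1)//.
  by rewrite /g /trunc_above le_max lerD2r fA.
rewrite EFinM -muleA; apply: (@le_trans _ _ ((1 - eta)%:E * Y)%E).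
  by rewrite lee_wpmul2l// lee_fin subr_ge0 ltW.
suff : ((1 - eta)%:E * Y <= r%:E * energy f)%E by [].
move: H2; rewrite -(fineK Yfin) -(fineK Efin) -!EFinM -EFinD !lee_fin.
by lra.
Qed.

End SmallSupport.

(** * A local Poincare inequality *)

Section PointwiseLipschitz.
Context {R : realType} {n : nat}.
Local Notation E := (Rn R n).
Implicit Types (F : E -> R) (x v w p : E).

(* [maxe 0] matters only for n = 0, where the supremum of the empty set is -oo. *)
Let lipnum_at F (k : nat) x : \bar R :=
  maxe 0%E (ereal_sup [set (`|F (x + w) - F x| / `|w|)%:E | w in
    [set w : E | 0 < `|w| < k.+1%:R^-1]]).

(** This is the limsup of [|F (x + w) - F x| / |w|] as [w] tends to 0, the suprema decreasing with
    the radius [1/(k+1)]. *)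
Definition lipnum F x : \bar R := einfs (fun k => lipnum_at F k x) 0.

Let lipnum_le_at F x k : (lipnum F x <= lipnum_at F k x)%E.
Proof. by apply: ereal_inf_lbound; exists k. Qed.

Lemma lipnum_ge0 F x : (0 <= lipnum F x)%E.
Proof. by apply/ereal_infP => _ [k _ <-]; rewrite le_max lexx. Qed.

(** At each scale the supremum runs over continuous functions of [x], so its strict superlevel sets
    are open, even though the family of [w] is uncountable; only the infimum over scales is
    countable. *)
Lemma measurable_lipnum F : continuous F -> measurable_fun [set: E] (lipnum F).
Proof.
move=> cF; apply: measurable_fun_einfs => k; apply: measurable_maxe => //.
apply: (measurability _ (ErealGenOInfty.measurableE R)) => /= _ [_ [a ->] <-].
rewrite setTI (_ : _ @^-1` _ = \bigcup_(w in [set w : E | 0 < `|w| < k.+1%:R^-1])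
    ((fun x => `|F (x + w) - F x| / `|w|) @^-1` `]a, +oo[%classic)).
  apply: open_measurable_Rn; apply: bigcup_open => w _.
  have cq : continuous (fun x => `|F (x + w) - F x| / `|w|).
    move=> x; apply: (@continuousM _ _ (fun x => `|F (x + w) - F x|) (cst `|w|^-1));
      last exact: cst_continuous.
    apply: (@continuous_comp _ _ _ (fun x => F (x + w) - F x) Num.norm).
      apply: (@continuousB _ _ _ (fun x => F (x + w)) F); last exact: cF.
      apply: (@continuous_comp _ _ _ (fun x : E => x + w) F); last exact: cF.
      by apply: (@continuousD _ _ _ id (cst w)); [by move=> B|exact: cst_continuous].
    exact: norm_continuous.
  by move/continuousP : cq; apply; exact: interval_open.
apply/seteqP; split => x /=.
  rewrite in_itv /= andbT => /ereal_sup_gt[_ [w wk <-]]; rewrite lte_fin => aw.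
  by exists w => //=; rewrite in_itv /= andbT.
move=> [w wk]; rewrite /= !in_itv /= !andbT => aw.
by apply: (@lt_le_trans _ _ (`|F (x + w) - F x| / `|w|)%:E);
  [rewrite lte_fin|apply: ereal_sup_ubound; exists w].
Qed.

(** The factor [n] appears because [|w|] is the sup norm while [gradnorm] is Euclidean: each of the
    [n] terms [p_i w_i] is at most [gradnorm F x * |w|]. *)
Lemma lipnum_le_gradnorm F x p : has_gradient F x p ->
  (lipnum F x <= (n%:R * gradnorm F x)%:E)%E.
Proof.
move=> Fp; apply/lee_addgt0Pr => e e0; have [d d0 H] := Fp e e0.
apply: le_trans (lipnum_le_at F x (Num.truncn d^-1)) _.
rewrite /lipnum_at ge_max -EFinD lee_fin addr_ge0 ?mulr_ge0 ?gradnorm_ge0 ?(ltW e0)//=.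
apply: ge_ereal_sup => _ [w /andP[w0 wk] <-]; rewrite lee_fin ler_pdivrMr//.
have wd : `|w| < d by apply: lt_trans wk _; rewrite invf_plt ?posrE// truncnS_gt.
have := H w wd; set s := \sum_i _ => Hw.
have sle : `|s| <= n%:R * gradnorm F x * `|w|.
  rewrite (le_trans (ler_norm_sum _ _ _))//.
  apply: (@le_trans _ _ (\sum_(i < n) gradnorm F x * `|w|)).
    by apply: ler_sum => i _; rewrite normrM ler_pM// ?le_gradnorm_coord// Rn_coord_le.
  by rewrite sumr_const card_ord -mulrnAl mulr_natl.
rewrite -[F (x + w) - F x](subrK s) (le_trans (ler_normD _ _))//.
by rewrite mulrDl addrC lerD.
Qed.

Lemma le_lipnum_derive F x v (t : R) : derivable (fun s : R => F (x + s *: v)) t 1 ->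
  (`|'D_1 (fun s : R => F (x + s *: v)) t|%:E <= `|v|%:E * lipnum F (x + t *: v)%R)%E.
Proof.
move=> dF; set y := x + t *: v.
have [v0|v0] := eqVneq v 0.
  rewrite (_ : (fun s => _) = cst (F x)) ?derive_cst ?normr0 ?mule_ge0 ?lipnum_ge0 ?lee_fin//.
  by apply/funext => s; rewrite v0 scaler0 addr0.
have v0' : 0 < `|v| by rewrite normr_gt0.
set g' := 'D_1 (fun s : R => F (x + s *: v)) t.
rewrite -lee_pdivrMl//.
apply/ereal_infP => _ [k _ <-]; rewrite /lipnum_at.
rewrite le_max; apply/orP; right.
apply/lee_addgt0Pr => e e0.
have /cvgrPdist_le/(_ (e * `|v|)) : (fun h => h^-1 *: (F (x + (h *: 1 + t) *: v) - F y)) @ 0^' --> g'.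
  exact: dF.
rewrite mulr_gt0// => /(_ isT)[d /= d0 dP].
pose h := Num.min d (k.+1%:R^-1 / `|v|) / 2.
have m0 : 0 < Num.min d (k.+1%:R^-1 / `|v|) by rewrite lt_min d0 divr_gt0 ?invr_gt0.
have h0 : 0 < h by rewrite divr_gt0.
have : h < Num.min d (k.+1%:R^-1 / `|v|) by rewrite /h ltr_pdivrMr// ltr_pMr// ltr1n.
rewrite lt_min ltr_pdivlMr// => /andP[hd hk].
have := dP h; rewrite /= sub0r normrN gtr0_norm// => /(_ hd (lt0r_neq0 h0)).
rewrite (_ : h%:A = h); last by rewrite /GRing.scale /= mulr1.
rewrite [h + t]addrC scalerDl addrA -/y => Hh.
apply: (@le_trans _ _ ((`|F (y + h *: v) - F y| / `|h *: v|)%:E + e%:E)%E); last first.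
  rewrite leeD2r//; apply: ereal_sup_ubound; exists (h *: v) => //=.
  by rewrite normrZ gtr0_norm// mulr_gt0.
rewrite -EFinM -EFinD lee_fin normrZ gtr0_norm// ler_pdivrMl// mulrDr.
have -> : `|v| * (`|F (y + h *: v) - F y| / (h * `|v|)) = `|h^-1 *: (F (y + h *: v) - F y)|.
  by rewrite normrZ gtr0_norm ?invr_gt0//; field; rewrite !gt_eqF.
rewrite -[g'](subrK (h^-1 *: (F (y + h *: v) - F y))) (le_trans (ler_normD _ _))//.
by rewrite addrC lerD2l (le_trans Hh)// mulrC.
Qed.

End PointwiseLipschitz.

(** * Integration along segments and the Poincare inequality on cubes *)

Section TranslationEstimate.
Context {R : realType} {n : nat}.
Local Notation E := (Rn R n).
Variable lam : {measure set E -> \bar R}.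
Hypothesis lamE : is_lebesgue_Rn lam.

(** By convexity the segment from [x] to [x + v] stays in the box, so [eps] is at most [|v|] times
    the integral of [lipnum F] along it. After Tonelli, each time [s] contributes a translate of the
    same integral. *)
Lemma le_integral_lipnum_shift (F : E -> R) (L eps : R) (a b v : E) (S : set E) :
  lipschitz_const L F -> measurable S -> S `<=` box a b -> (forall x, S x -> box a b (x + v)) ->
  0 <= eps -> (forall x, S x -> eps <= `|F (x + v) - F x|) ->
  (eps%:E * lam S <= `|v|%:E * \int[lam]_(x in box a b) lipnum F x)%E.
Proof.
move=> FL mS SK SvK eps0 Seps.
have cF := lipschitz_const_continuous _ _ FL.
(* Extension by 0 outside the box makes translation invariance on the whole space applicable. *)
pose HK x := ((\1_(box a b) x)%:E * lipnum F x)%E.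
have HK0 x : (0 <= HK x)%E by rewrite mule_ge0 ?lipnum_ge0// lee_fin.
have mHK : measurable_fun [set: E] HK.
  apply: emeasurable_funM; last exact: measurable_lipnum.
  by apply/measurable_EFinP; apply: measurable_indic; exact: measurable_box.
have intHK : (\int[lam]_(x in box a b) lipnum F x = \int[lam]_x HK x)%E.
  rewrite integral_mkcond; apply: eq_integral => x _; rewrite patchE /HK indicE.
  by case: (x \in box a b); rewrite ?mul1e ?mul0e.
pose f (z : E * measurableTypeR R) : \bar R :=
  ((\1_(`[0%R, 1%R]%classic) z.2)%:E * (`|v|%:E * HK (z.1 + (z.2 : R) *: v)%R))%E.
have f0 z : (0 <= f z)%E by apply: mule_ge0; [rewrite lee_fin|exact: mule_ge0].
have mf : measurable_fun [set: E * measurableTypeR R] f.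
  apply: emeasurable_funM.
    apply: (@measurableT_comp _ _ _ _ _ _ 
      (fun s : measurableTypeR R => (\1_(`[0%R, 1%R]%classic) s)%:E)) => //.
    by apply/measurable_EFinP; apply: measurable_indic; exact: measurable_itv.
  by apply: measurable_funeM; apply: measurableT_comp mHK _; exact: measurable_line.
have FT := @fubini_tonelli _ _ _ _ R (as_sigma_finite _ _ _ _ (lebesgue_sigma_finite lam lamE))
  (@lebesgue_measure R) f mf f0.
have inner x : S x -> (eps%:E <= \int[@lebesgue_measure R]_s f (x, s))%E.
  move=> Sx; apply: (@le_trans _ _ (`|F (x + v) - F x|%:E)); first by rewrite lee_fin Seps.
  have := lipschitz_le_integral_upper _ (fun s : R => F (x + s *: v)) (L * `|v|)
    (fun s => `|v|%:E * HK (x + s *: v)%R)%E (lipschitz_const_line _ _ _ _ FL).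
  rewrite scale1r scale0r addr0 => /(_ _ _ _)/le_trans; apply.
  - apply: measurable_funeM; apply: measurableT_comp mHK _.
    apply: measurable_fun_Rn => i; under eq_fun do rewrite !mxE.
    by apply: measurable_funD => //; exact: measurable_funM.
  - by move=> s; rewrite mule_ge0.
  - move=> s /andP[s0 s1] ds; apply: le_trans (le_lipnum_derive _ _ _ _ ds) _.
    rewrite lee_wpmul2l// /HK indicE mem_set ?mul1e// => i.
    have /andP[h1 h2] := SK _ Sx i; have /andP[] := SvK _ Sx i; rewrite !mxE => h3 h4.
    apply/andP; split; first by nra.
    by nra.
  rewrite integral_mkcond le_eqVlt; apply/orP; left; apply/eqP.
  apply: eq_integral => s _; rewrite patchE /f /= indicE.
  by case: (s \in _); rewrite ?mul1e ?mul0e.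
apply: (@le_trans _ _ (\int[lam]_x \int[@lebesgue_measure R]_s f (x, s))%E).
  have -> : lam S = (\int[lam]_x (\1_S x)%:E)%E by rewrite integral_indic// setIT.
  rewrite -ge0_integralZl//; last by apply/measurable_EFinP; exact: measurable_indic.
  apply: ge0_le_lower_integral => x; first by rewrite mule_ge0// lee_fin.
  rewrite indicE; have [xS|xS] := boolP (x \in S).
    by rewrite mule1; apply: inner; rewrite inE in xS.
  by rewrite mule0 integral_ge0.
rewrite [leLHS]FT intHK.
rewrite (eq_integral (fun s : measurableTypeR R => (\1_(`[0%R, 1%R]%classic) s)%:E *
    (`|v|%:E * \int[lam]_x HK x))%E); last first.
  move=> s _; rewrite /f /= ge0_integralZl//; last 2 first.
  - apply: measurable_funeM; apply: measurableT_comp mHK _; exact: measurable_addr.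
  - by move=> x _; rewrite mule_ge0.
  rewrite ge0_integralZl//; last by apply: measurableT_comp mHK _; exact: measurable_addr.
  by rewrite (ge0_integral_lebesgue_shift lam lamE (s *: v) HK).
rewrite ge0_integralZr//; last 2 first.
- by apply/measurable_EFinP; apply: measurable_indic; exact: measurable_itv.
- by rewrite mule_ge0// integral_ge0.
rewrite integral_indic//.
by rewrite setIT /= lebesgue_measure_itv /= lte_fin ltr01 oppr0 adde0 mul1e.
Qed.

Local Notation cube M := (box (const_mx (- M)) (const_mx M)).

(** Slicing the pairs by their difference, [lam S * lam T] is the integral over [v] of the measure
    of the points [x] in [S] with [x + v] in [T]. A nonempty slice forces [|v| <= 2 * M], and the
    previous estimate applies to it. *)
Lemma cube_poincare (F : E -> R) (L eps M : R) (S T : set E) :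
  lipschitz_const L F -> 0 <= M -> 0 <= eps -> measurable S -> measurable T ->
  S `<=` cube M -> T `<=` cube M -> (forall x y, S x -> T y -> eps <= `|F y - F x|) ->
  (eps%:E * (lam S * lam T) <=
    lam (cube (2 * M)) * ((2 * M)%:E * \int[lam]_(x in cube M) lipnum F x))%E.
Proof.
move=> FL M0 eps0 mS mT SK TK ST.
pose A : set (E * E) := (S `*` setT) `&` ((fun p => p.1 + p.2) @^-1` T).
have mA : measurable A.
  apply: measurableI; first exact: measurableX.
  by rewrite -[X in measurable X]setTI; exact: measurable_add2.
pose slam := as_sigma_finite _ _ _ _ (lebesgue_sigma_finite lam lamE).
have := @indic_fubini_tonelli _ _ _ _ R slam slam A mA.
rewrite indic_fubini_tonelli_FE// indic_fubini_tonelli_GE//.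
have I0 : (0 <= \int[lam]_(x in cube M) lipnum F x)%E.
  by apply: integral_ge0 => x _; exact: lipnum_ge0.
rewrite [LHS](eq_integral (fun x => (\1_S x)%:E * lam T)%E); last first.
  move=> x _ /=; rewrite indicE; have [xS|xS] := boolP (x \in S) => /=.
    rewrite mul1e -(lebesgue_shift lam lamE x T mT); congr (lam _).
    rewrite inE in xS; apply/seteqP; split => v; rewrite /xsection /A /= inE /=.
      by case=> _; rewrite addrC.
    by rewrite [v + x]addrC.
  rewrite mul0e -(measure0 lam); congr (lam _).
  apply/seteqP; split => // v; rewrite /xsection /A /= inE /= => -[[xS' _] _].
  by rewrite notin_setE in xS.
rewrite ge0_integralZr//; last by apply/measurable_EFinP; exact: measurable_indic.
rewrite integral_indic// setIT => STE.
have {}STE : (lam S * lam T = _)%E := STE.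
rewrite STE.
rewrite -ge0_integralZl//; last exact: measurable_fun_ysection.
rewrite -[X in (X * _)%E](_ : (\int[lam]_x (\1_(cube (2 * M)) x)%:E)%E = _); last first.
  by rewrite integral_indic ?setIT//; exact: measurable_box.
rewrite -ge0_integralZr//; last 2 first.
- by apply/measurable_EFinP; apply: measurable_indic; exact: measurable_box.
- by rewrite mule_ge0// lee_fin mulr_ge0.
apply: ge0_le_lower_integral => v; first by rewrite mule_ge0// lee_fin.
have [A0|/set0P[x]] := eqVneq (ysection A v) set0.
  by rewrite /= A0 measure0 mule0 mule_ge0 ?lee_fin// mule_ge0// lee_fin mulr_ge0.
rewrite /ysection /A /= inE /= => -[[Sx _] Txv].
have vM i : `|v ord0 i| <= 2 * M.
  have := SK _ Sx i; have := TK _ Txv i; rewrite !mxE => /andP[? ?] /andP[? ?].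
  by rewrite ler_norml; apply/andP; split; lra.
rewrite indicE mem_set ?mul1e; last by move=> i; rewrite !mxE -ler_norml.
apply: le_trans (_ : (`|v|%:E * \int[lam]_(x in cube M) lipnum F x <= _)%E); last first.
  by rewrite lee_wpmul2r// lee_fin; apply/Rn_norm_le; rewrite ?mulr_ge0.
apply: le_integral_lipnum_shift FL _ _ _ eps0 _.
- exact: measurable_ysection.
- by move=> y; rewrite /ysection /A /= inE /= => -[[Sy _] _]; exact: SK.
- by move=> y; rewrite /ysection /A /= inE /= => -[_ Ty]; exact: TK.
- by move=> y; rewrite /ysection /A /= inE /= => -[[Sy _] Ty]; exact: ST.
Qed.

End TranslationEstimate.

(** * Reduction of locally Lipschitz functions to globally Lipschitz ones *)

Section Clamp.
Context {R : realType} {n : nat}.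
Local Notation E := (Rn R n).
Local Notation cube M := (box (const_mx (- M)) (const_mx M)).

(** The nearest-point retraction onto a cube, which is 1-Lipschitz for the sup norm. Composing with
    it makes a locally Lipschitz function globally Lipschitz without changing it on the cube. *)
Definition clamp (M : R) (x : E) : E :=
  \row_i Num.max (- M) (Num.min M (x ord0 i)).

Lemma clamp_in M x : 0 <= M -> cube M (clamp M x).
Proof.
move=> M0 i; rewrite !mxE le_max lexx ge_max ge_min lexx /= andbT; lra.
Qed.

Lemma clamp_id M x : cube M x -> clamp M x = x.
Proof.
move=> xM; apply/matrixP => a i; rewrite mxE (ord1 a).
by have := xM i; rewrite !mxE => /andP[h1 h2]; rewrite min_r// max_r.
Qed.

Lemma clamp_dist M x y : `|clamp M x - clamp M y| <= `|x - y|.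
Proof.
apply/Rn_norm_le => // i; apply: le_trans (Rn_coord_le _ i).
have maxD (c u w : R) : `|Num.max c u - Num.max c w| <= `|u - w|.
  have h1 : u - w <= `|u - w| := ler_norm _.
  have h2 : w - u <= `|u - w| by rewrite distrC ler_norm.
  by case: (leP c u) => ?; case: (leP c w) => ?; rewrite ler_norml; apply/andP; split; lra.
have minD (c u w : R) : `|Num.min c u - Num.min c w| <= `|u - w|.
  have h1 : u - w <= `|u - w| := ler_norm _.
  have h2 : w - u <= `|u - w| by rewrite distrC ler_norm.
  by case: (leP c u) => ?; case: (leP c w) => ?; rewrite ler_norml; apply/andP; split; lra.
by rewrite !mxE (le_trans (maxD _ _ _)).
Qed.

Lemma compact_cube M : compact (cube M : set E).
Proof.
have -> : (cube M : set E) = [set v : 'rV[R]_n | forall i, `[- M, M]%classic (v ord0 i)].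
  apply/seteqP; split => v H i; have := H i; rewrite !mxE /= in_itv //=.
have : compact [set v : 'rV[R]_n | forall i, `[- M, M]%classic (v ord0 i)].
  exact: (@rV_compact _ _ (fun=> `[- M, M]%classic) (fun _ => @segment_compact _ _ _)).
by [].
Qed.

(** Compactness gives a common scale [1/(k+1)] at which the constant [k+1] works. Pairs further
    apart are handled by [0 <= f <= 1], since there [(k+1) * |y - z| >= 1]. *)
Lemma locally_lipschitz_cube (f : E -> R) M : locally_lipschitz f ->
  (forall x, 0 <= f x <= 1) ->
  exists k, forall y z, cube M y -> cube M z -> `|f y - f z| <= k * `|y - z|.
Proof.
move=> /locally_lipschitzP fL f01.
pose P (k : nat) (x : E) := forall y z : E, `|x - y| < k.+1%:R^-1 -> `|x - z| < k.+1%:R^-1 ->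
  `|f y - f z| <= k.+1%:R * `|y - z|.
have : \forall k \near \oo, cube M `<=` P k.
  have /compact_near_coveringP := compact_cube M; apply => x _.
  have [r r0 [k Hk]] := fL x.
  exists (ball x (r / 2), [set j : nat | (Num.truncn (Num.max (2 / r) k) <= j)%N]) => /=.
    split; first by apply: nbhsx_ballx; rewrite divr_gt0.
    by exists (Num.truncn (Num.max (2 / r) k)).
  move=> [x' j] /= []; rewrite -ball_normE /= => xx' tj y z x'y x'z.
  have : Num.max (2 / r) k < j.+1%:R.
    by apply: lt_le_trans (truncnS_gt _) _; rewrite ler_nat ltnS.
  rewrite gt_max => /andP[rj kj].
  have jr : j.+1%:R^-1 < r / 2 by rewrite -[X in _ < X]invrK invf_div ltf_pV2 ?posrE ?divr_gt0.
  have near_x (u : E) : `|x' - u| < j.+1%:R^-1 -> `|x - u| < r.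
    move=> x'u; rewrite -[x](subrK x') -addrA (le_lt_trans (ler_normD _ _))//.
    by rewrite [ltRHS]splitr ltrD// (lt_trans x'u).
  apply: le_trans (Hk _ _ (near_x _ x'y) (near_x _ x'z)) _.
  by rewrite ler_wpM2r// ltW.
move=> [k _ /(_ k (leqnn k))] HP; exists k.+1%:R => y z yM zM.
have [yz|yz] := ltP `|y - z| k.+1%:R^-1.
  by apply: (HP y yM) => //; rewrite subrr normr0 invr_gt0.
apply: (@le_trans _ _ 1); last by rewrite -ler_pdivrMl// mulr1.
have /andP[? ?] := f01 y; have /andP[? ?] := f01 z.
by rewrite ler_norml; apply/andP; split; lra.
Qed.

Lemma lipschitz_clamp (f : E -> R) M : 0 <= M -> locally_lipschitz f ->
  (forall x, 0 <= f x <= 1) -> exists L, lipschitz_const L (f \o clamp M).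
Proof.
move=> M0 fL f01; have [k Hk] := locally_lipschitz_cube f M fL f01.
exists `|k| => x y /=; apply: le_trans (Hk _ _ (clamp_in _ _ M0) (clamp_in _ _ M0)) _.
apply: (@le_trans _ _ (`|k| * `|clamp M x - clamp M y|)).
  by rewrite ler_wpM2r// ler_norm.
by rewrite ler_wpM2l// clamp_dist.
Qed.

(** The margin 1 makes [clamp] the identity near every point of the smaller cube, including its
    boundary. *)
Lemma has_gradient_clamp (f : E -> R) M x p : cube M x ->
  has_gradient (f \o clamp (M + 1)) x p -> has_gradient f x p.
Proof.
move=> xM; apply: has_gradient_local; exists 1 => // w w1.
have xw (u : E) : `|u| < 1 -> cube (M + 1) (x + u).
  move=> u1 i; have := xM i; rewrite !mxE => /andP[h1 h2].
  have := le_lt_trans (Rn_coord_le u i) u1; rewrite ltr_norml => /andP[h3 h4].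
  by apply/andP; split; lra.
have x0 := xw 0; rewrite normr0 addr0 in x0.
by rewrite /= !clamp_id//; [exact: x0|exact: xw].
Qed.

End Clamp.

(** * Energy of functions with mass both at 0 and above a level *)

Section EnergyLowerBound.
Context {R : realType} {n : nat}.
Local Notation E := (Rn R n).
Local Notation cube M := (box (const_mx (- M)) (const_mx M)).
Variables (lam : {measure set E -> \bar R}) (mu : probability E R).
Hypothesis lamE : is_lebesgue_Rn lam.
Hypothesis comparable : forall M : R, exists2 c : R, 0 < c & forall A : set E,
  measurable A -> A `<=` cube M -> (lam A <= c%:E * mu A /\ mu A <= c%:E * lam A)%E.

Let large_cube (e : R) : 0 < e -> exists j : nat, (mu (~` cube j%:R) <= e%:E)%E.
Proof.
move=> e0; pose B (k : nat) : set E := ~` cube k%:R.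
have mB k : measurable (B k) by apply: measurableC; exact: measurable_box.
have capB : \bigcap_k B k = set0.
  by rewrite /B -setC_bigcup bigcup_box_setT setCT.
have := @nonincreasing_cvg_mu _ _ _ mu B; rewrite capB measure0.
move=> /(_ _ mB measurable0) /=.
have -> : (mu (B 0%N) < +oo)%E.
  by rewrite (le_lt_trans (probability_le1 mu (mB 0%N)))// ltry.
move=> /(_ isT); have ndB : {homo B : k m / (k <= m)%N >-> (m <= k)%O}.
  move=> k m km; apply/subsetPset => x; apply: contra_not => xk i.
  have := xk i; rewrite !mxE => /andP[h1 h2].
  have : k%:R <= m%:R :> R by rewrite ler_nat.
  by move=> ?; apply/andP; split; lra.
move=> /(_ ndB)/fine_cvgP[finB].
move=> /cvgrPdist_le/(_ e e0) H.
have [k [kf kH]] : exists k, mu (B k) \is a fin_num /\ `|0 - fine (mu (B k))| <= e.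
  by near \oo => k; exists k; split; near: k.
exists k; rewrite -(fineK kf) lee_fin; move: kH.
by rewrite sub0r normrN ger0_norm// fine_ge0.
Unshelve. all: by end_near. Qed.

(** A form of Cauchy-Schwarz that can be integrated pointwise and stays valid for [x = +oo]. *)
Let amgm (t : R) (x : \bar R) : 0 < t -> (0 <= x)%E -> (x <= t%:E + (t^-1)%:E * (x * x))%E.
Proof.
move=> t0; case: x => [x| |//]; last first.
  by rewrite mulyy gt0_muley ?lte_fin ?invr_gt0// addey// leey.
rewrite lee_fin => x0; rewrite -!EFinM -EFinD lee_fin -subr_ge0.
rewrite (_ : _ - _ = t^-1 * ((t - x) ^+ 2 + x * t)); last first.
  by field; rewrite gt_eqF.
by rewrite mulr_ge0 ?invr_ge0 ?(ltW t0)// addr_ge0 ?sqr_ge0// mulr_ge0// ltW.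
Qed.

Let integral_lipnum_le_energy (f : E -> R) (M c : R) :
  0 <= M -> 0 < c -> locally_lipschitz f -> (forall x, 0 <= f x <= 1) ->
  (forall A, measurable A -> A `<=` cube M -> (lam A <= c%:E * mu A)%E) ->
  (\int[lam]_(x in cube M) (lipnum (f \o clamp (M + 1)) x * lipnum (f \o clamp (M + 1)) x) <=
   (n.+1%:R ^+ 2 * c)%:E * \int[mu]_x ((gradnorm f x) ^+ 2)%:E)%E.
Proof.
move=> M0 c0 fL f01 lammu; set F := f \o clamp (M + 1).
have [L FL] : exists L, lipschitz_const L F by apply: lipschitz_clamp => //; rewrite addr_ge0.
have cF := lipschitz_const_continuous _ _ FL.
have [N [mN N0 NS]] := rademacher lam lamE _ _ FL.
(* Removing the Rademacher null set [N] makes the comparison with [gradnorm f] hold at every point,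
   as the lower integral requires, while [q] itself is Borel. *)
pose q x : \bar R := ((\1_(cube M `\` N) x)%:E * (lipnum F x * lipnum F x))%E.
have mK : measurable (cube M : set E) by exact: measurable_box.
have mKN : measurable (cube M `\` N) by exact: measurableD.
have ml := measurable_lipnum _ cF.
have l0 x : (0 <= lipnum F x * lipnum F x)%E by rewrite mule_ge0 ?lipnum_ge0.
have ml2 : measurable_fun [set: E] (fun x => lipnum F x * lipnum F x)%E by exact: emeasurable_funM.
have q0 x : (0 <= q x)%E by apply: mule_ge0 => //; rewrite lee_fin.
have mq : measurable_fun [set: E] q.
  by apply: emeasurable_funM => //; apply/measurable_EFinP; exact: measurable_indic.
have qgrad x : (((n.+1%:R ^+ 2)^-1)%:E * q x <= ((gradnorm f x) ^+ 2)%:E)%E.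
  rewrite /q indicE; have [xK|xK] := boolP (x \in _); last first.
    by rewrite mul0e mule0 lee_fin sqr_ge0.
  rewrite inE in xK; case: xK => xK xN.
  have [p Fp] : exists p, has_gradient F x p by apply: contrapT => np; apply: xN; apply: NS.
  have lF := lipnum_le_gradnorm _ _ _ Fp.
  have fp : has_gradient f x p := has_gradient_clamp f M x p xK Fp.
  rewrite (gradnorm_has_gradient _ _ _ Fp) -(gradnorm_has_gradient _ _ _ fp) in lF.
  rewrite mul1e lee_pdivrMl ?exprn_gt0//.
  apply: (@le_trans _ _ ((n%:R * gradnorm f x)%:E * (n%:R * gradnorm f x)%:E)%E).
    by apply: lee_pmul; rewrite ?lipnum_ge0.
  rewrite -!EFinM lee_fin -expr2 exprMn ler_wpM2r ?sqr_ge0//.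
  by rewrite ler_sqr ?nnegrE// ler_nat.
have cn : 0 <= c by exact: ltW.
have le_q : (\int[lam]_(x in cube M) q x <= c%:E * \int[mu]_x q x)%E.
  have mKC : measurable (~` cube M : set E) by exact: measurableC.
  (* The bound of [lam] by [c * mu] is known inside the cube only. Adding [lam] restricted to the
     complement gives a measure dominating [lam] on all sets, and the added part does not charge the
     cube. *)
  pose m2 : {measure set E -> \bar R} :=
    measure_add (mscale (NngNum cn) mu) (mrestr lam mKC).
  have m2E A : m2 A = (mscale (NngNum cn) mu A + mrestr lam mKC A)%E.
    exact: measure_addE.
  have m12 A : measurable A -> (lam A <= m2 A)%E.
    move=> mA; rewrite m2E /= /mrestr /mscale /=.
    rewrite -[in leLHS](setIT A) -(setUv (cube M)) setIUr.
    apply: le_trans (measureU2 _ _ _) _; try exact: measurableI.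
    rewrite leeD2r// (le_trans (lammu _ (measurableI _ _ mA mK) (@subIsetr _ _ _)))//.
    rewrite lee_wpmul2l ?lee_fin//; apply: le_measure; rewrite ?inE//.
    exact: measurableI.
  apply: le_trans (ge0_le_measure_integral m12 mK q0 mq) _.
  have mqK : measurable_fun (cube M) q by exact: measurable_funTS.
  rewrite ge0_integral_measure_add// ge0_integral_mscale//=.
  rewrite [X in (_ + X)%E]null_set_integral//; last first.
    by rewrite /= /mrestr setICr measure0.
  rewrite adde0 lee_wpmul2l ?lee_fin//; apply: ge0_subset_integral => //.
apply: (@le_trans _ _ (\int[lam]_(x in cube M) q x)%E).
  rewrite le_eqVlt; apply/orP; left; apply/eqP; apply: ge0_ae_eq_integral => //.
  - exact: measurable_funTS.
  - exact: measurable_funTS.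
  exists N; split => // x /= /not_implyP[xK]; apply: contra_notP => xN.
  by rewrite /q indicE mem_set ?mul1e.
apply: le_trans le_q _; rewrite mulrC EFinM -muleA lee_wpmul2l ?lee_fin//.
rewrite -lee_pdivrMl ?exprn_gt0// -ge0_integralZl//.
apply: ge0_le_lower_integral => // x.
by rewrite mule_ge0// lee_fin invr_ge0 sqr_ge0.
Qed.

(* [eps a b <= C I] with [I <= th lam(K) + J / th] (AM-GM) and [J <= C' E] bound the
   energy E from below by a constant that only depends on m and eps. *)
Lemma spread_energy_lower_bound (m eps : R) : 0 < m -> 0 < eps -> exists2 c : R, 0 < c &
  forall f : E -> R, locally_lipschitz f -> (forall x, 0 <= f x <= 1) ->
    ((2^-1)%:E <= mu [set x | f x = 0%R])%E -> (m%:E <= mu [set x | (eps < f x)%R])%E ->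
    (c%:E <= \int[mu]_x ((gradnorm f x) ^+ 2)%:E)%E.
Proof.
move=> m0 eps0.
(* The cube misses so little mass that the zero set keeps mass [1/4] inside it and the superlevel
   set [m / 2]. *)
have [|j mj] := large_cube (Num.min (m / 2) 4^-1); first by rewrite lt_min divr_gt0//= invr_gt0.
pose M : R := j%:R; have M0 : 0 <= M by exact: ler0n.
have [c c0 cP] := comparable M.
have mK : measurable (cube M : set E) by exact: measurable_box.
pose lamK := fine (lam (cube M)); pose lam2 := fine (lam (cube (2 * M))).
have lamKE : lam (cube M) = lamK%:E.
  by rewrite fineK// ge0_fin_numE// lebesgue_box_lty.
have lam2E : lam (cube (2 * M)) = lam2%:E.
  by rewrite fineK// ge0_fin_numE// lebesgue_box_lty.
have lamK0 : 0 <= lamK by exact: fine_ge0.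
have lam20 : 0 <= lam2 by exact: fine_ge0.
(* [a] and [b] will bound [lam S] and [lam T] from below through [mu <= c * lam], [dl] is the
   resulting bound for the integral of [lipnum], and [th] makes [th * lamK] at most half of [dl].
   The added 1s keep the divisors positive even when [M = 0]. *)
pose Q := lam2 * (2 * M) + 1.
have Q0 : 0 < Q by rewrite ltr_wpDl// mulr_ge0// mulr_ge0.
pose a := (4 * c)^-1; pose b := m / (2 * c).
have a0 : 0 < a by rewrite invr_gt0 mulr_gt0.
have b0 : 0 < b by rewrite divr_gt0// mulr_gt0.
pose dl := eps * (a * b) / Q.
have dl0 : 0 < dl by rewrite divr_gt0// mulr_gt0// mulr_gt0.
pose th := dl / (2 * (lamK + 1)).
have th0 : 0 < th by rewrite divr_gt0// mulr_gt0// ltr_wpDl.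
pose C' := n.+1%:R ^+ 2 * c; have C'0 : 0 < C' by rewrite mulr_gt0// exprn_gt0.
exists (th * (dl / 2) / C'); first by rewrite divr_gt0// mulr_gt0// divr_gt0.
move=> f fL f01 mS mT; set En := (\int[mu]_x _)%E.
set F := f \o clamp (M + 1).
have [L FL] : exists L, lipschitz_const L F by apply: lipschitz_clamp => //; rewrite addr_ge0.
have cF := lipschitz_const_continuous _ _ FL.
have mf : measurable_fun [set: E] f.
  by apply: continuous_measurable_Rn; exact: locally_lipschitz_continuous.
have Ff x : cube M x -> F x = f x.
  move=> xM; rewrite /F /= clamp_id// => i; have := xM i; rewrite !mxE => /andP[? ?].
  by apply/andP; split; lra.
pose S := [set x | f x = 0%R] `&` cube M; pose T := [set x | (eps < f x)%R] `&` cube M.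
have mS0 : measurable [set x | f x = 0%R].
  rewrite -[X in measurable X]setTI (_ : [set x | f x = 0%R] = f @^-1` [set 0%R])//.
  by apply: mf => //; exact: measurable_set1.
have mT0 : measurable [set x | (eps < f x)%R].
  rewrite (_ : [set x | _] = f @^-1` `]eps, +oo[%classic).
    by rewrite -[X in measurable X]setTI; apply: mf => //; exact: measurable_itv.
  by apply/seteqP; split => x /=; rewrite in_itv /= andbT.
have mSm : measurable S by exact: measurableI.
have mTm : measurable T by exact: measurableI.
have split_cube (A : set E) (r e : R) : measurable A -> (mu (~` cube M) <= e%:E)%E ->
    (r%:E <= mu A)%E -> ((r - e)%:E <= mu (A `&` cube M))%E.
  move=> mA me rA; rewrite EFinB leeBlDr//.
  apply: le_trans rA _; rewrite -[in leLHS](setIT A) -(setUv (cube M)) setIUr.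
  have mAK : measurable (A `&` cube M) by exact: measurableI.
  have mKC : measurable (~` cube M : set E) by exact: measurableC.
  have mAC : measurable (A `&` ~` cube M) by exact: measurableI.
  apply: le_trans (measureU2 _ mAK mAC) _.
  by rewrite leeD2l// (le_trans _ me)//; apply: le_measure; rewrite ?inE.
have muS : (4^-1%:E <= mu S)%E.
  have me : (mu (~` cube M) <= (4^-1)%:E)%E.
    by apply: le_trans mj _; rewrite lee_fin ge_min lexx orbT.
  apply: le_trans (split_cube _ _ _ mS0 me mS); rewrite lee_fin; lra.
have muT : ((m / 2)%:E <= mu T)%E.
  have me : (mu (~` cube M) <= (m / 2)%:E)%E.
    by apply: le_trans mj _; rewrite lee_fin ge_min lexx.
  apply: le_trans (split_cube _ _ _ mT0 me mT); rewrite lee_fin; lra.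
have lamS : (a%:E <= lam S)%E.
  have [_ h] := cP S mSm (@subIsetr _ _ _).
  rewrite /a invfM mulrC EFinM lee_pdivrMl//; exact: le_trans muS h.
have lamT : (b%:E <= lam T)%E.
  have [_ h] := cP T mTm (@subIsetr _ _ _).
  rewrite /b invfM mulrA mulrC EFinM lee_pdivrMl//; exact: le_trans muT h.
set I := (\int[lam]_(x in cube M) lipnum F x)%E.
have I0 : (0 <= I)%E by apply: integral_ge0 => x _; exact: lipnum_ge0.
have dlI : (dl%:E <= I)%E.
  rewrite /dl mulrC EFinM lee_pdivrMl//.
  apply: (@le_trans _ _ (eps%:E * (lam S * lam T))%E).
    rewrite !EFinM lee_wpmul2l ?lee_fin ?(ltW eps0)//.
    by apply: lee_pmul; rewrite // lee_fin ltW.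
  apply: le_trans (cube_poincare lam lamE F L eps M S T FL M0 (ltW eps0) mSm mTm _ _ _) _.
  - exact: subIsetr.
  - exact: subIsetr.
  - move=> x y [fx xM] [fy yM]; rewrite !Ff// fx subr0.
    by apply: le_trans (ler_norm _); exact: ltW.
  by rewrite lam2E muleA -EFinM lee_wpmul2r// lee_fin lerDl.
have ml : measurable_fun (cube M) (lipnum F) by apply: measurable_funTS; exact: measurable_lipnum.
set J := (\int[lam]_(x in cube M) (lipnum F x * lipnum F x))%E.
have IJ : (I <= (th * lamK)%:E + (th^-1)%:E * J)%E.
  have ml2 : measurable_fun (cube M) (fun x => lipnum F x * lipnum F x)%E by exact: emeasurable_funM.
  have -> : ((th * lamK)%:E + (th^-1)%:E * J =
      \int[lam]_(x in cube M) (th%:E + (th^-1)%:E * (lipnum F x * lipnum F x)))%E.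
    rewrite ge0_integralD//; last 3 first.
    - by move=> x _; rewrite lee_fin ltW.
    - by move=> x _; rewrite !mule_ge0 ?lipnum_ge0// lee_fin invr_ge0 ltW.
    - exact: measurable_funeM.
    rewrite integral_cst// EFinM -lamKE ge0_integralZl//.
    - by move=> x _; rewrite mule_ge0 ?lipnum_ge0.
    - by rewrite lee_fin invr_ge0 ltW.
  apply: ge0_le_integral => //.
  - by move=> x _; exact: lipnum_ge0.
  - by apply: emeasurable_funD => //; exact: measurable_funeM.
  - by move=> x _; apply: amgm => //; exact: lipnum_ge0.
have JE : (J <= C'%:E * En)%E.
  apply: integral_lipnum_le_energy => // A mA AK.
  by have [] := cP A mA AK.
have thlam : th * lamK <= dl / 2.
  have l1 : 0 < lamK + 1 by rewrite ltr_wpDl.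
  have -> : th * lamK = dl / 2 * (lamK / (lamK + 1)) by rewrite /th invfM; ring.
  have dl2 : 0 <= dl / 2 by rewrite ltW// divr_gt0.
  by rewrite ler_piMr// ler_pdivrMr// mul1r lerDl.
have half : ((dl / 2)%:E <= (th^-1)%:E * J)%E.
  have := le_trans dlI IJ; rewrite -leeBlDl// -EFinB; apply: le_trans.
  by rewrite lee_fin; lra.
rewrite mulrC EFinM lee_pdivrMl//; apply: le_trans JE.
by rewrite EFinM -lee_pdivlMl//; exact: half.
Qed.

End EnergyLowerBound.

(** * Capacity *)

Section Capacity.
Context {R : realType} {n : nat}.
Local Notation E := (Rn R n).
Local Notation cube M := (box (const_mx (- M)) (const_mx M)).
Variables (lam : {measure set E -> \bar R}) (mu : probability E R).

(** A continuous potential is bounded on the compact cube, so the density has positive bounds there;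
    [b * (Z + Z^-1)] dominates both ratios [b * Z] and [b / Z]. *)
Lemma gibbs_comparable (V : E -> R) : continuous V ->
  (forall A : set E, measurable A ->
     mu A = (\int[lam]_(x in A)
              (expR (- V x) / fine (\int[lam]_y (expR (- V y))%:E))%:E)%E) ->
  forall M : R, exists2 c : R, 0 < c & forall A : set E,
    measurable A -> A `<=` cube M -> (lam A <= c%:E * mu A /\ mu A <= c%:E * lam A)%E.
Proof.
move=> cV muE M; set Z := fine _ in muE.
(* For [Z = 0] the density would be 0 by the convention on inverses, against total mass 1. An
   infinite integral, whose [fine] is 0, is excluded in the same way. *)
have Z0 : 0 < Z.
  have Zge0 : 0 <= Z by apply/fine_ge0/integral_ge0 => x _; rewrite lee_fin expR_ge0.
  rewrite lt_neqAle Zge0 andbT; apply/negP => /eqP ZE.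
  have := probability_setT mu; rewrite muE// integral0_eq; last first.
    by move=> x _; rewrite -ZE invr0 mulr0.
  by move=> /eqP; rewrite eq_sym onee_eq0.
have cK : compact (V @` cube M).
  by apply: continuous_compact; [exact: continuous_subspaceT|exact: compact_cube].
have [B [_ HB]] := compact_bounded cK.
have {}HB x : cube M x -> `|V x| <= B + 1.
  by move=> xM; apply: (HB (B + 1)); [rewrite ltrDl|exists x].
pose b := expR (B + 1); have b0 : 0 < b by exact: expR_gt0.
have mrho : measurable_fun [set: E] (fun x => (expR (- V x) / Z)%:E).
  apply/measurable_EFinP; apply: measurable_funM => //.
  apply: measurableT_comp => //; apply: measurableT_comp => //.
  exact: continuous_measurable_Rn.
exists (b * (Z + Z^-1)); first by rewrite mulr_gt0// addr_gt0// invr_gt0.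
move=> A mA AM.
have rho0 x : (0 <= (expR (- V x) / Z)%:E)%E by rewrite lee_fin divr_ge0 ?expR_ge0 ?ltW.
split.
  apply: (@le_trans _ _ ((b * Z)%:E * mu A)%E); last first.
    by rewrite lee_wpmul2r// lee_fin ler_wpM2l ?ltW// ltrDl invr_gt0.
  rewrite -lee_pdivrMl ?mulr_gt0// muE// -integral_cst//; apply: ge0_le_integral => //.
  - by move=> x _; rewrite lee_fin invr_ge0 mulr_ge0// ltW.
  - exact: measurable_funTS.
  move=> x Ax; rewrite lee_fin invfM ler_wpM2r ?invr_ge0 ?(ltW Z0)//.
  rewrite /b -expRN ler_expR lerN2; apply: le_trans (HB x (AM x Ax)).
  exact: ler_norm.
apply: (@le_trans _ _ ((b / Z)%:E * lam A)%E); last first.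
  by rewrite lee_wpmul2r// lee_fin ler_wpM2l ?ltW// ltrDr.
rewrite muE// -integral_cst//; apply: ge0_le_integral => //.
- exact: measurable_funTS.
move=> x Ax; rewrite lee_fin ler_wpM2r ?invr_ge0 ?(ltW Z0)// ler_expR.
by apply: le_trans (HB x (AM x Ax)); rewrite -normrN ler_norm.
Qed.

Hypothesis lamE : is_lebesgue_Rn lam.
Hypothesis comparable : forall M : R, exists2 c : R, 0 < c & forall A : set E,
  measurable A -> A `<=` cube M -> (lam A <= c%:E * mu A /\ mu A <= c%:E * lam A)%E.
Variables (r0 : R) (beta : R -> R).
Hypotheses (r0_ge0 : 0 <= r0) (spi : partial_SPI mu r0 beta).

Lemma test_energy_lower_bound (c : R) : 0 < c -> c * r0 < 1 ->
  exists2 c1 : R, 0 < c1 & forall (A : set E) (f : E -> R), measurable A ->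
    admissible mu f -> (forall x, A x -> 1 <= f x) -> (forall x, f x <= 1) ->
    (mu [set x | f x != 0%R] <= (2^-1)%:E)%E ->
    (c1%:E <= \int[mu]_x ((gradnorm f x) ^+ 2)%:E)%E \/
    (c%:E * mu A <= \int[mu]_x ((gradnorm f x) ^+ 2)%:E)%E.
Proof.
move=> c0 cr0.
(* A value strictly between [r0] and [1/c] leaves the margin [1 - c * r > 0] to spend on [eps] and
   [eta]. *)
pose r := (r0 + c^-1) / 2.
have ci : r0 < c^-1 by rewrite -[c^-1]mul1r ltr_pdivlMr// mulrC.
have r0r : r0 < r by rewrite /r; lra.
have rgt0 : 0 < r by exact: le_lt_trans r0r.
have cr : c * r < 1.
  have : r < c^-1 by rewrite /r; lra.
  by rewrite -[c^-1]mul1r ltr_pdivlMr// mulrC.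
(* [e] serves as both [eps] and [eta], because [(1 - e)^3 >= 1 - 3 e = c * r]. *)
pose e := (1 - c * r) / 3.
have cr_gt0 : 0 < c * r by rewrite mulr_gt0.
have e0 : 0 < e by rewrite /e; lra.
have e1 : e < 1 by rewrite /e; lra.
have ecr : c * r <= (1 - e) * (1 - e) ^+ 2.
  have : c * r = 1 - 3 * e by rewrite /e; field.
  by move=> ->; rewrite expr2; nra.
have b0 : 0 < Num.max (beta r) 0 + 1 by rewrite ltr_wpDl// le_max lexx orbT.
pose m := e / (Num.max (beta r) 0 + 1); have m0 : 0 < m by rewrite divr_gt0.
have bm : Num.max (beta r) 0 * m <= e.
  by rewrite /m mulrA ler_pdivrMr// mulrC ler_wpM2l ?ltW// ltrDl.
have [c1 c10 Hc1] := spread_energy_lower_bound lam mu lamE comparable m e m0 e0.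
exists c1 => // A f mA fadm fA f1 fsupp; have [fL [_ fE]] := fadm.
have cf := locally_lipschitz_continuous _ fL.
have mf : measurable_fun [set: E] f by exact: continuous_measurable_Rn.
have [small|large] := leP (mu [set x | (e < f x)%R]) m%:E.
  right; have := SPI_small_support mu r0 beta r e e m f A spi r0r rgt0 fadm f1 _ e1 m0 bm small mA fA.
  rewrite (ltW e0) e1 => /(_ isT) H.
  have : ((c * r)%:E * mu A <= r%:E * \int[mu]_x ((gradnorm f x) ^+ 2)%:E)%E.
    by apply: le_trans H; rewrite lee_wpmul2r// lee_fin.
  by rewrite mulrC EFinM -muleA lee_pmul2l// lte_fin.
(* Test functions may be negative off [A], whereas the energy bound is for values in [[0, 1]];
   taking the positive part does not raise the energy. *)
left; pose g := trunc_above 0 f.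
have g0 x : 0 <= g x by exact: trunc_above_ge0.
apply: (@le_trans _ _ (\int[mu]_x ((gradnorm g x) ^+ 2)%:E)%E); last first.
  apply: ge0_le_lower_integral => x; rewrite lee_fin ?sqr_ge0//.
  by rewrite ler_sqr ?nnegrE ?gradnorm_ge0// gradnorm_trunc_above.
apply: Hc1.
- exact: trunc_above_locally_lipschitz.
- by move=> x; rewrite g0 /g /trunc_above subr0 ge_max f1 ler01.
- have mf0 : measurable [set x | f x != 0%R].
    rewrite (_ : [set x | _] = ~` (f @^-1` [set 0%R])); last first.
      by apply/seteqP; split => x /eqP.
    apply: measurableC; rewrite -[X in measurable X]setTI; apply: mf => //.
  have mg0 : measurable [set x | g x = 0%R].
    rewrite -[X in measurable X]setTI (_ : [set x | g x = 0%R] = g @^-1` [set 0%R])//.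
    have mg : measurable_fun [set: E] g.
      apply: continuous_measurable_Rn; apply: locally_lipschitz_continuous.
      exact: trunc_above_locally_lipschitz.
    by apply: mg.
  have h : (mu (~` [set x | f x != 0%R]) <= mu [set x | g x = 0%R])%E.
    apply: le_measure; rewrite ?inE//; first exact: measurableC.
    by move=> x /= /negP/negPn/eqP fx; rewrite /g /trunc_above fx subr0 maxxx.
  apply: le_trans h; rewrite probability_setC//.
  rewrite leeBrDl; last by rewrite ge0_fin_numE// (le_lt_trans fsupp)// ltry.
  apply: le_trans (leeD fsupp (lexx _)) _; rewrite -EFinD lee_fin; lra.
- apply: ltW; apply: lt_le_trans large _; apply: le_measure; rewrite ?inE.
  + rewrite (_ : [set x | _] = f @^-1` `]e, +oo[%classic).
      by rewrite -[X in measurable X]setTI; apply: mf => //; exact: measurable_itv.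
    by apply/seteqP; split => x /=; rewrite in_itv /= andbT.
  + rewrite (_ : [set x | _] = f @^-1` `]e, +oo[%classic).
      by rewrite -[X in measurable X]setTI; apply: mf => //; exact: measurable_itv.
    apply/seteqP; split => x /=; rewrite in_itv /= andbT /g /trunc_above subr0.
      by rewrite lt_max [e < 0]ltNge (ltW e0) orbF.
    by move=> h; rewrite lt_max h.
  + by move=> x /= ex; rewrite /g /trunc_above subr0 lt_max ex.
Qed.

(** Since [c1] does not depend on [A], the linear term is the minimum as soon as
    [mu A <= c1 / c]. *)
Lemma capacity_lower_bound (c : R) : 0 < c -> c * r0 < 1 ->
  exists2 c1 : R, 0 < c1 & forall A : set E, measurable A ->
    (Order.min c1%:E (c%:E * mu A) <= capacity mu A)%E.
Proof.
move=> c0 cr0; have [c1 c10 H] := test_energy_lower_bound c c0 cr0.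
exists c1 => // A mA; apply/ereal_infP => _ [f [fadm [fA [f1 fsupp]]] <-].
by rewrite ge_min; apply/orP; exact: H.
Qed.

End Capacity.

(** The last clause expresses the lower limit without dividing by [r0]: for [r0 = 0] every real [c]
    qualifies, which is divergence to [+oo]. *)
Theorem theorem3p2 (R : realType) (n : nat)
    (lam : {measure set (Rn R n) -> \bar R}) (V : Rn R n -> R)
    (mu : probability (Rn R n) R) (r0 : R) (beta : R -> R) :
  is_lebesgue_Rn lam ->
  smooth V ->
  (\int[lam]_x (expR (- V x))%:E < +oo)%E ->
  (forall A : set (Rn R n), measurable A ->
     mu A = (\int[lam]_(x in A)
              (expR (- V x) / fine (\int[lam]_y (expR (- V y))%:E))%:E)%E) ->
  0 <= r0 ->
  partial_SPI mu r0 beta ->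
  exists C : R -> R,
    (forall kappa : R, 0 < kappa <= 2^-1 ->
       0 < C kappa /\
       forall A : set (Rn R n), measurable A -> (mu A <= kappa%:E)%E ->
         ((C kappa)%:E * mu A <= capacity mu A)%E) /\
    (forall c : R, c * r0 < 1 -> \forall kappa \near 0^'+, c <= C kappa).
Proof.
move=> lamE smV _ muE r0_ge0 spi.
have comp := gibbs_comparable lam mu V (smV 0%N) muE.
have cap_lb := capacity_lower_bound lam mu lamE comp r0 beta r0_ge0 spi.
have mufin A : measurable A -> mu A \is a fin_num.
  by move=> mA; rewrite ge0_fin_numE// (le_lt_trans (probability_le1 mu mA))// ltry.
have cap0 A : (0 <= capacity mu A)%E.
  by apply/ereal_infP => _ [f _ <-]; apply: integral_ge0 => x _; rewrite lee_fin sqr_ge0.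
pose good (kappa c : R) := forall A : set (Rn R n), measurable A -> (mu A <= kappa%:E)%E ->
  (c%:E * mu A <= capacity mu A)%E.
(* A constant valid for all [kappa] comes from [c = 1/(r0 + 1)]: as [mu A <= 1], the term [c1] is at
   least [c1 * mu A]. *)
have [C0 C00 goodC0] : exists2 C0 : R, 0 < C0 & forall kappa, good kappa C0.
  have rp : 0 < r0 + 1 by rewrite ltr_wpDl.
  have c0 : 0 < (r0 + 1)^-1 by rewrite invr_gt0.
  have cr : (r0 + 1)^-1 * r0 < 1 by rewrite mulrC ltr_pdivrMr// mul1r ltrDl.
  have [c1 c10 H] := cap_lb _ c0 cr.
  exists (Num.min c1 (r0 + 1)^-1); first by rewrite lt_min c10.
  move=> kappa A mA _; apply: le_trans (H A mA); rewrite le_min; apply/andP; split.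
    apply: (@le_trans _ _ (c1%:E * 1)%E); last by rewrite mule1.
    by apply: lee_pmul => //; rewrite ?probability_le1// lee_fin ?ge_min ?lexx// le_min !ltW.
  by rewrite lee_wpmul2r// lee_fin ge_min lexx orbT.
(* [C kappa] is the supremum of the admissible constants. Without a cap this set could be unbounded,
   for instance if the capacities are infinite; the cap [1/kappa] grows as [kappa] tends to 0 and so
   excludes no fixed [c] in the limit. *)
pose S kappa := [set c : R | c <= Num.max C0 kappa^-1 /\ good kappa c].
have SC0 kappa : S kappa C0 by split; [rewrite le_max lexx|exact: goodC0].
have Sub kappa : has_ubound (S kappa) by exists (Num.max C0 kappa^-1) => c [].
have leS kappa c : S kappa c -> c <= sup (S kappa).
  by move=> Sc; apply: ub_le_sup.
exists (fun kappa => sup (S kappa)); split.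
  move=> kappa _; split; first exact: lt_le_trans (leS _ _ (SC0 kappa)).
  move=> A mA mukappa; have muA := mufin A mA.
  case capE : (capacity mu A) => [q| |]; [|exact: leey|]; last first.
    by have := cap0 A; rewrite capE.
  have q0 : 0 <= q by have := cap0 A; rewrite capE lee_fin.
  rewrite -(fineK muA) -EFinM lee_fin.
  have a0 : 0 <= fine (mu A) by exact: fine_ge0.
  move: a0; rewrite le_eqVlt => /orP[/eqP <-|a0]; first by rewrite mulr0.
  rewrite -ler_pdivlMr//; apply: sup_le_ub => [|c [_ gc]]; first by exists C0.
  rewrite ler_pdivlMr// -lee_fin EFinM fineK// -capE; exact: gc.
move=> c cr0; have [c0|c0] := leP c 0.
  by near=> kappa; apply: (le_trans c0); apply: ltW; exact: lt_le_trans (leS _ _ (SC0 kappa)).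
have [c1 c10 H] := cap_lb c c0 cr0.
(* Two thresholds are used: [kappa <= 1/c] puts [c] below the cap, and [kappa <= c1 / c] makes
   [c * mu A] at most [c1]. *)
near=> kappa; have k0 : 0 < kappa by near: kappa; exact: nbhs_right_gt.
apply: leS; split.
  rewrite le_max; apply/orP; right; rewrite -[kappa^-1]mul1r ler_pdivlMr// mulrC -ler_pdivlMr//.
  by near: kappa; apply: nbhs_right_le; rewrite mul1r invr_gt0.
move=> A mA mukappa; apply: le_trans (H A mA); rewrite le_min lexx andbT.
apply: (@le_trans _ _ (c%:E * kappa%:E)%E); first by rewrite lee_wpmul2l// lee_fin ltW.
rewrite -EFinM lee_fin mulrC -ler_pdivlMr//.
by near: kappa; apply: nbhs_right_le; rewrite divr_gt0.
Unshelve. all: by end_near. Qed.
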